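(* Let $M$ be an $n$-dimensional simply connected smooth manifold, and let $F$ be a Finsler metric on $M$ with induced quasi-metric $d_F$. Then $d_F$ is a generalized weighted quasi-metric on $M$ (that is, there exists a function $w:M\to\mathbb{R}$ such that $d_F(x,y)+w(x)=d_F(y,x)+w(y)$ for all $x,y\in M$) if and only if there exist an absolute homogeneous Finsler metric $F_0$ on $M$ and an exact one-form $\beta$ on $M$ such that $F=F_0+\beta$, i.e. $F$ is the Randers change of $F_0$ by the exact one-form $\beta$.
   Context: A Finsler metric on a smooth manifold $M$ is a function $F:TM\to[0,\infty)$, $C^\infty$ on $TM\setminus\{0\}$, positively homogeneous of degree one on each fibre ($F(x,\lambda v)=\lambda F(x,v)$ for $\lambda>0$), and such that the fibrewise Hessian of $\frac12F^2$ is positive definite on $TM\setminus\{0\}$. It is absolute homogeneous if $F(x,-v)=F(x,v)$ for all $(x,v)\in TM\setminus\{0\}$. The induced distance is $d_F(x,y):=\inf_{\gamma}\int_a^bF(\gamma(t),\dot\gamma(t))\,dt$, the infimum being over all piecewise $C^\infty$ curves $\gamma:[a,b]\to M$ with $\gamma(a)=x$, $\gamma(b)=y$. A quasi-metric on a set $X$ is a function $d:X\times X\to[0,\infty)$ with: $d(x,x)=0$ and $d(x,y)>0$ if $x\ne y$; $d(x,y)\le d(x,z)+d(z,y)$; and $d(x,y)=d(y,x)=0\Rightarrow x=y$. A quasi-metric $d$ on $X$ is a generalized weighted quasi-metric if there is a function $w:X\to\mathbb{R}$ (a generalized weight) such that $d(x,y)+w(x)=d(y,x)+w(y)$ for all $x,y\in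 X$. A Randers change of a Finsler metric $F_0$ by a one-form $\beta$ is a Finsler metric of the form $F(x,v)=F_0(x,v)+\beta_x(v)$. *)

(* Defs.v *)
From HB Require Import structures.
From mathcomp Require Import all_boot all_order all_algebra.
From mathcomp Require Import all_classical all_reals all_analysis.

Set Implicit Arguments.
Unset Strict Implicit.
Unset Printing Implicit Defensive.

Import Order.TTheory GRing.Theory Num.Theory.
Import numFieldNormedType.Exports.

Local Open Scope classical_set_scope.
Local Open Scope ring_scope.

(* [Ck k U f]: f is of class C^k on U.  It is only used for open U and
   finite-dimensional V, W; there it says that f is k times differentiable on U
   and that all directional derivatives of order at most k are continuous. *)
Fixpoint Ck (R : realType) (V W : normedModType R) (k : nat)
    (U : set V) (f : V -> W) : Prop :=
  if k is k'.+1
  then (forall x, U x -> differentiable f x) /\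
       (forall v : V, Ck k' U ('D_v f))
  else forall x, U x -> {for x, continuous f}.

Definition smooth_on (R : realType) (V W : normedModType R)
    (U : set V) (f : V -> W) : Prop := forall k, Ck k U f.

Lemma near_eq_diff (R : realType) (V W : normedModType R) (f g : V -> W)
    (x y : V) : differentiable f x -> differentiable g x ->
  (\forall u \near x, f u = g u) -> 'd f x y = 'd g x y.
Proof.
move=> df dg fg; rewrite -!deriveE//.
have [->|y0] := eqVneq y 0; first by rewrite !derive0.
exact: near_eq_derive.
Qed.

Lemma diff_chain (R : realType) (U V W : normedModType R)
    (f : U -> V) (g : V -> W) (h : U -> W) (x y : U) (z : V) : f x = z ->
  differentiable f x -> differentiable g z -> differentiable h x ->
  (\forall u \near x, g (f u) = h u) -> 'd g z ('d f x y) = 'd h x y.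
Proof.
move=> <- df dg dh gfh; rewrite -(near_eq_diff y _ dh gfh).
  by rewrite (diff_comp df dg).
exact: differentiable_comp.
Qed.

(* The map [cinv] is the inverse of the homeomorphism [ccoord] from [cdom] onto
   its (open) image; the values of [ccoord] outside [cdom] and of [cinv] outside
   that image are irrelevant. *)
Record chart (R : realType) (n : nat) (M : topologicalType) := Chart {
  cdom : set M;
  ccoord : M -> 'rV[R]_n;
  cinv : 'rV[R]_n -> M;
  cdom_open : open cdom;
  cimg_open : open (ccoord @` cdom);
  ccoordK : forall p, cdom p -> cinv (ccoord p) = p;
  ccoord_continuous : forall p, cdom p -> {for p, continuous ccoord};
  cinv_continuous :
    forall x, (ccoord @` cdom) x -> {for x, continuous cinv}
}.

Definition cimg (R : realType) (n : nat) (M : topologicalType)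
  (c : chart R n M) : set 'rV[R]_n := ccoord c @` cdom c.

Definition transition (R : realType) (n : nat) (M : topologicalType)
  (c c' : chart R n M) : 'rV[R]_n -> 'rV[R]_n := ccoord c' \o cinv c.

(* A smooth structure is given by a (not necessarily maximal) smooth atlas. *)
Record manifold (R : realType) (n : nat) := Manifold {
  points :> topologicalType;
  points_hausdorff : hausdorff_space points;
  points_second_countable : @second_countable points;
  index : Type;
  atlas : index -> chart R n points;
  atlas_cover : forall p : points, exists i, cdom (atlas i) p;
  atlas_compat : forall i j,
    smooth_on (ccoord (atlas i) @` (cdom (atlas i) `&` cdom (atlas j)))
              (transition (atlas i) (atlas j))
}.

Section Tangent.
Variables (R : realType) (n : nat) (M : manifold R n).
Local Notation dom i := (cdom (@atlas R n M i)).
Local Notation phi i := (ccoord (@atlas R n M i)).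
Local Notation psi i := (cinv (@atlas R n M i)).
Local Notation tau i j := (transition (@atlas R n M i) (@atlas R n M j)).

Lemma cdom_nbhs i (p : M) : dom i p -> \forall q \near p, dom i q.
Proof. by move=> ip; apply: open_nbhs_nbhs; split=> //; exact: cdom_open. Qed.

Lemma transition_overlap_nbhs i j (p : M) : dom i p -> dom j p ->
  \forall x \near phi i p, cimg (atlas i) x /\ dom j (psi i x).
Proof.
move=> ip jp; near=> x; split.
  by near: x; apply: open_nbhs_nbhs; split; [exact: cimg_open|exists p].
near: x.
have /(_ (dom j)) := @cinv_continuous _ _ _ (atlas i) (phi i p) (ex_intro2 _ _ p ip erefl).
by rewrite ccoordK//; apply; exact: cdom_nbhs.
Unshelve. all: by end_near. Qed.

Lemma transition_differentiable i j (p : M) : dom i p -> dom j p ->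
  differentiable (tau i j) (phi i p).
Proof. by move=> ip jp; apply: (atlas_compat i j 1%N).1; exists p. Qed.

(* A tangent vector at p is the family of its coordinate vectors in the charts
   around p, related by the differentials of the transition maps; components at
   charts not containing p are set to 0, so that equal vectors have equal
   families. *)
Definition tangent_family (p : M) : {pred index M -> 'rV[R]_n} :=
  fun v => `[< (forall i, ~ dom i p -> v i = 0) /\
    (forall i j, dom i p -> dom j p -> v j = 'd (tau i j) (phi i p) (v i)) >].

Fact tangent_family_submod (p : M) : submod_closed (tangent_family p).
Proof.
split; first by apply/asboolP; split=> [//|i j ip jp]; rewrite linear0.
move=> a u v /asboolP[u0 uE] /asboolP[v0 vE]; apply/asboolP; split.
  by move=> i ip; rewrite addrfctE scalrfctE /= u0// v0// scaler0 addr0.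
by move=> i j ip jp; rewrite !addrfctE !scalrfctE /= linearP -uE// -vE.
Qed.

HB.instance Definition _ (p : M) :=
  GRing.isSubmodClosed.Build R (index M -> 'rV[R]_n) (tangent_family p)
    (tangent_family_submod p).

Record tangent (p : M) := Tangent {
  tcoord :> index M -> 'rV[R]_n;
  tangentP : tcoord \in tangent_family p
}.

HB.instance Definition _ (p : M) := [isSub for @tcoord p].
HB.instance Definition _ (p : M) := [Choice of tangent p by <:].
HB.instance Definition _ (p : M) := [SubChoice_isSubLmodule of tangent p by <:].

Definition tvec_family (i : index M) (p : M) (y : 'rV[R]_n) :
    index M -> 'rV[R]_n :=
  fun j => if pselect (dom i p /\ dom j p) then 'd (tau i j) (phi i p) y else 0.

Lemma transition_cocycle i j k (p : M) y : dom i p -> dom j p -> dom k p ->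
  'd (tau j k) (phi j p) ('d (tau i j) (phi i p) y) = 'd (tau i k) (phi i p) y.
Proof.
move=> ip jp kp; apply: diff_chain.
- by rewrite /transition /= ccoordK.
- exact: transition_differentiable.
- exact: transition_differentiable.
- exact: transition_differentiable.
near=> x.
have [_ jx] : cimg (atlas i) x /\ dom j (psi i x).
  by near: x; exact: transition_overlap_nbhs.
by rewrite /transition /= ccoordK.
Unshelve. all: by end_near. Qed.

Lemma tvec_familyE i j (p : M) y : dom i p -> dom j p ->
  tvec_family i p y j = 'd (tau i j) (phi i p) y.
Proof. by move=> ip jp; rewrite /tvec_family; case: pselect => [|[]]. Qed.

Lemma tvec_family0 i j (p : M) y : ~ (dom i p /\ dom j p) ->
  tvec_family i p y j = 0.
Proof. by rewrite /tvec_family; case: pselect. Qed.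

Lemma tvec_subproof i p y : tvec_family i p y \in tangent_family p.
Proof.
apply/asboolP; split=> [j jp|j k jp kp]; first by rewrite tvec_family0// => -[].
have [ip|nip] := pselect (dom i p).
  rewrite (tvec_familyE y ip jp) (tvec_familyE y ip kp).
  exact/esym/(transition_cocycle y ip jp kp).
have nip' l : ~ (dom i p /\ dom l p) by case.
by rewrite (tvec_family0 y (nip' j)) (tvec_family0 y (nip' k)) linear0.
Qed.

Definition tvec (i : index M) (p : M) (y : 'rV[R]_n) : tangent p :=
  Tangent (tvec_subproof i p y).

Lemma tvecK i p y : dom i p -> tvec i p y i = y.
Proof.
move=> ip; rewrite [LHS]tvec_familyE//.
have id_diff : differentiable (@id 'rV[R]_n) (phi i p) by [].
have d_id : 'd (@id 'rV[R]_n) (phi i p) y = y.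
  by rewrite -(deriveE y id_diff) derive_id.
rewrite -[RHS]d_id; apply: near_eq_diff.
- exact: transition_differentiable.
- exact: id_diff.
near=> x.
have [[q iq <-] _] : cimg (atlas i) x /\ dom i (psi i x).
  by near: x; exact: transition_overlap_nbhs.
by rewrite /transition /= ccoordK.
Unshelve. all: by end_near. Qed.

Lemma tcoordK i p (v : tangent p) : dom i p -> tvec i p (v i) = v.
Proof.
move=> ip; apply: val_inj; apply/funext => j /=.
have /asboolP[v0 vE] := tangentP v.
have [jp|njp] := pselect (dom j p); first by rewrite tvec_familyE// -vE.
by rewrite tvec_family0 ?v0// => -[].
Qed.

Definition smooth_function (f : M -> R) : Prop :=
  forall i, smooth_on (cimg (atlas i)) (f \o psi i).

Definition smooth_curve_on (A : set R) (g : R -> M) : Prop :=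
  (forall t, A t -> {for t, continuous g}) /\
  (forall i, smooth_on (A `&` (g @^-1` dom i)) (phi i \o g)).

(* g is piecewise smooth on [a, b]: there is a subdivision of [a, b] such that g
   extends smoothly past the end points of each closed piece. *)
Definition piecewise_smooth (a b : R) (g : R -> M) : Prop :=
  exists (k : nat) (s : nat -> R), [/\ s 0%N = a, s k = b &
    forall j, (j < k)%N -> s j < s j.+1 /\
      exists (A : set R) (h : R -> M),
        [/\ open A, smooth_curve_on A h &
            forall t, s j <= t <= s j.+1 -> A t /\ g t = h t]].

Definition chart_at (p : M) : index M := projT1 (cid (atlas_cover p)).

(* It does not depend on the chosen chart at g t, where g is differentiable.
   The value is junk where g is not differentiable, e.g. at the break points of
   a piecewise smooth curve. *)
Definition velocity (g : R -> M) (t : R) : tangent (g t) :=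
  tvec (chart_at (g t)) (g t) (derive1 (phi (chart_at (g t)) \o g) t).

Definition local_expr (F : forall p : M, tangent p -> R) (i : index M)
    (z : 'rV[R]_n * 'rV[R]_n) : R :=
  F (psi i z.1) (tvec i (psi i z.1) z.2).

(* The Hessian of F^2/2 on the tangent space at p, at the vector with
   coordinates y in the chart i, as a bilinear form in these coordinates. *)
Definition fibre_hessian (F : forall p : M, tangent p -> R) (i : index M)
    (p : M) (y u w : 'rV[R]_n) : R :=
  'D_u ('D_w (fun z => 2^-1 * F p (tvec i p z) ^+ 2)) y.

Record finsler_metric := FinslerMetric {
  finsler :> forall p : M, tangent p -> R;
  finsler_ge0 : forall p (v : tangent p), 0 <= finsler v;
  finsler_smooth : forall i,
    smooth_on [set z | cimg (atlas i) z.1 /\ z.2 != 0] (local_expr finsler i);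
  finsler_homogeneous : forall p (v : tangent p) (l : R),
    0 < l -> finsler (l *: v) = l * finsler v;
  finsler_convex : forall i p, dom i p -> forall y u : 'rV[R]_n,
    y != 0 -> u != 0 -> 0 < fibre_hessian finsler i p y u u
}.

Definition absolute_homogeneous (F : finsler_metric) : Prop :=
  forall (p : M) (v : tangent p), v != 0 -> F p (- v) = F p v.

Definition curve_length (F : finsler_metric) (a b : R) (g : R -> M) : R :=
  \int[lebesgue_measure]_(t in `[a, b]%classic) F (g t) (velocity g t).

(* On a connected manifold this is the infimum of a nonempty set of nonnegative
   reals, so that the junk value [inf set0 = 0] does not occur. *)
Definition finsler_dist (F : finsler_metric) (x y : M) : R :=
  inf [set l : R | exists (a b : R) (g : R -> M),
    [/\ a < b, piecewise_smooth a b g, g a = x, g b = y &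
        l = curve_length F a b g]].

Record one_form := OneForm {
  form :> forall p : M, {scalar tangent p};
  form_smooth : forall (i : index M) (y : 'rV[R]_n),
    smooth_on (cimg (atlas i))
      (fun x => form (psi i x) (tvec i (psi i x) y))
}.

Definition is_differential (f : M -> R) (beta : one_form) : Prop :=
  forall i p, dom i p -> forall v : tangent p,
    beta p v = 'd (f \o psi i) (phi i p) (v i).

Definition exact_form (beta : one_form) : Prop :=
  exists f : M -> R, smooth_function f /\ is_differential f beta.

Definition randers_change (F F0 : finsler_metric) (beta : one_form) : Prop :=
  forall (p : M) (v : tangent p), F p v = F0 p v + beta p v.

End Tangent.

Definition simply_connected (R : realType) (X : topologicalType) : Prop :=
  (forall x y : X, exists g : R -> X,
     [/\ {within `[0, 1]%classic, continuous g}, g 0 = x & g 1 = y]) /\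
  (forall (x : X) (g : R -> X),
     {within `[0, 1]%classic, continuous g} -> g 0 = x -> g 1 = x ->
     exists H : R * R -> X,
       [/\ {within `[0, 1]%classic `*` `[0, 1]%classic, continuous H},
           forall t : R, 0 <= t <= 1 -> H (0, t) = g t,
           forall t : R, 0 <= t <= 1 -> H (1, t) = x &
           forall s : R, 0 <= s <= 1 -> H (s, 0) = x /\ H (s, 1) = x]).

Record quasi_metric (R : realType) (X : Type) (d : X -> X -> R) : Prop :=
  QuasiMetric {
    qm_ge0 : forall x y, 0 <= d x y;
    qm_refl : forall x, d x x = 0;
    qm_pos : forall x y, x <> y -> 0 < d x y;
    qm_triangle : forall x y z, d x y <= d x z + d z y;
    qm_separated : forall x y, d x y = 0 -> d y x = 0 -> x = y
  }.

Definition generalized_weighted (R : realType) (X : Type)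
    (d : X -> X -> R) : Prop :=
  quasi_metric d /\
  exists w : X -> R, forall x y, d x y + w x = d y x + w y.

(* Main.v *)
From HB Require Import structures.
Require Import Defs.
From mathcomp Require Import all_boot all_order all_algebra.
From mathcomp Require Import all_classical all_reals all_analysis.
From mathcomp Require Import measurable_realfun.
From mathcomp Require Import ring lra.

(* Both directions rest on the comparison, near a point x0 of a chart,
     (1 - e) F(x0, x2 - x1) <= d_F(x1, x2) <= (1 + e) F(x0, x2 - x1).
   The upper bound is the length of a segment.  For the lower bound, the
   differential at x2 - x1 of the norm F(x0, .) is a linear form dominated by
   this norm (convexity), so it calibrates the curves staying in the chart, and
   short curves do stay there.

   If w is a weight, then w(x2) - w(x1) = d_F(x1, x2) - d_F(x2, x1) is therefore
   F(x0, x2 - x1) - F(x0, x1 - x2) up to e |x2 - x1|.  This strict differentiability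
   makes v |-> F(v) - F(-v) additive, hence linear, and equal to dw; so w is smooth,
   beta = dw/2 and F0(v) = (F(v) + F(-v))/2.  Since F0 = F - beta, the fibrewise
   second derivative of F0 is that of F, which gives the convexity of F0.

   Conversely, if F = F0 + df, reversing a curve from x to y changes its length by
   2 (f(x) - f(y)), so 2 f is a weight.  Simple connectedness is only used
   through connectedness, to make distances infima of nonempty sets. *)

Set Implicit Arguments.
Unset Strict Implicit.
Unset Printing Implicit Defensive.

Import Order.TTheory GRing.Theory Num.Theory.
Import numFieldNormedType.Exports.

Local Open Scope classical_set_scope.
Local Open Scope ring_scope.

(** * Differentiability and C^k maps *)

Section Differentiability.
Context {R : realType}.
Implicit Types V W : normedModType R.

(** The comparison freezes the metric at [x0]: the calibrating form has constant coefficients in the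
    chart, hence is closed, and it bounds lengths up to the factor 1 - e without geodesics or an
    exponential map. Both end points vary around the fixed base [x0]; with one of them kept at [x0],
    only one-sided derivatives of the weight at [x0] would result, and additivity in v would not
    follow. Three obstacles shape the statements. F is not assumed differentiable on the zero
    section, although velocities may vanish, so zero vectors are treated apart. The velocity has
    junk values at break points, so lengths are compared through primitives of the speed off a
    finite list. The Hessian of F0^2/2 is not that of F^2/2: what linear forms leave unchanged is
    the second derivative of the norm itself, and positive definiteness has to be transported
    through it. *)

Lemma differentiable_littleoP V W (f : V -> W) (L : {linear V -> W}) (x : V) :
  continuous L ->
  (forall e, 0 < e -> \forall h \near 0, `|f (h + x) - f x - L h| <= e * `|h|) ->
  differentiable f x /\ 'd f x = L :> (V -> W).
Proof.
move=> cL fL.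
have fE : f \o shift x = cst (f x) + L +o_ 0 id.
  apply/eqaddoP => e e0; have := fL _ e0; apply: filterS => h.
  by rewrite !fctE /= opprD addrA.
have dE := diff_unique cL fE; split=> //.
by apply/diff_locallyP; rewrite dE.
Qed.

Lemma differentiable_littleo V W (f : V -> W) (x : V) : differentiable f x ->
  forall e, 0 < e -> \forall h \near 0, `|f (h + x) - f x - 'd f x h| <= e * `|h|.
Proof.
move=> /diff_locally /eqaddoP fE e e0; have := fE e e0; apply: filterS => h /=.
by rewrite !fctE /= opprD addrA.
Qed.

Lemma near_eq_differentiable V W (f g : V -> W) (x : V) :
  (\forall u \near x, f u = g u) -> differentiable f x -> differentiable g x.
Proof.
move=> fg df.
have [] := @differentiable_littleoP V W g ('d f x) x (diff_continuous df); last by [].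
move=> e e0; have := differentiable_littleo df e0.
have := fg; rewrite (near_shift 0) subr0 => fg0.
apply: filterS2 fg0 => h /= fgh.
by rewrite fgh (nbhs_singleton fg).
Qed.

End Differentiability.

Section CkCalculus.
Context {R : realType}.
Implicit Types V W : normedModType R.

Lemma Ck_subset V W k (U U' : set V) (f : V -> W) :
  U `<=` U' -> Ck k U' f -> Ck k U f.
Proof.
elim: k f => [|k IH] f UU' /=; first by move=> fU x /UU'; exact: fU.
by move=> [df Df]; split=> [x /UU'/df //|v]; apply: IH.
Qed.

Lemma smooth_on_subset V W (U U' : set V) (f : V -> W) :
  U `<=` U' -> smooth_on U' f -> smooth_on U f.
Proof. by move=> UU' sf k; exact: Ck_subset (sf k). Qed.

Lemma Ck_eq V W k (U : set V) (f g : V -> W) : open U ->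
  (forall x, U x -> f x = g x) -> Ck k U f -> Ck k U g.
Proof.
move=> oU; elim: k f g => [|k IH] f g fg.
  move=> cf x Ux; have nU : nbhs x U by exact: open_nbhs_nbhs.
  rewrite /prop_for /continuous_at -fg//.
  apply: cvg_trans (cf x Ux); apply: near_eq_cvg.
  by apply: filterS nU => y Uy; rewrite fg.
move=> [df Df]; split=> [x Ux|v].
  apply: near_eq_differentiable (df x Ux).
  by apply: filterS (open_nbhs_nbhs (conj oU Ux)) => y Uy; rewrite fg.
apply: IH (Df v) => x Ux; apply: near_eq_derive.
by apply: filterS (open_nbhs_nbhs (conj oU Ux)) => y Uy; rewrite fg.
Qed.

Lemma CkD V W k (U : set V) (f g : V -> W) : open U ->
  Ck k U f -> Ck k U g -> Ck k U (f + g).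
Proof.
move=> oU; elim: k f g => [|k IH] f g.
  by move=> cf cg x Ux; apply: continuousD; [exact: cf|exact: cg].
move=> [df Df] [dg Dg]; split=> [x Ux|v].
  by apply: differentiableD; [exact: df|exact: dg].
apply: Ck_eq (IH _ _ (Df v) (Dg v)) => // x Ux.
by rewrite deriveD//; apply: diff_derivable; [exact: df|exact: dg].
Qed.

Lemma CkZ V W k (U : set V) (a : R) (f : V -> W) : open U ->
  Ck k U f -> Ck k U (a *: f).
Proof.
move=> oU; elim: k f => [|k IH] f.
  by move=> cf x Ux; apply: continuousZl_tmp; exact: cf.
move=> [df Df]; split=> [x Ux|v].
  by apply: differentiableZ; exact: df.
apply: Ck_eq (IH _ (Df v)) => // x Ux.
by rewrite deriveZ//; apply: diff_derivable; exact: df.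
Qed.

Lemma smooth_onD V W (U : set V) (f g : V -> W) : open U ->
  smooth_on U f -> smooth_on U g -> smooth_on U (f + g).
Proof. by move=> oU sf sg k; exact: CkD. Qed.

Lemma smooth_onZ V W (U : set V) (a : R) (f : V -> W) : open U ->
  smooth_on U f -> smooth_on U (a *: f).
Proof. by move=> oU sf k; exact: CkZ. Qed.

Lemma smooth_on_differentiable V W (U : set V) (f : V -> W) (x : V) :
  smooth_on U f -> U x -> differentiable f x.
Proof. by move=> sf Ux; apply: (sf 1%N).1. Qed.

Lemma smooth_on_derive V W (U : set V) (f : V -> W) (v : V) :
  smooth_on U f -> smooth_on U ('D_v f).
Proof. by move=> sf k; exact: (sf k.+1).2. Qed.

Lemma Ck_cst V W k (U : set V) (c : W) : Ck k U (cst c : V -> W).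
Proof.
elim: k c => [|k IH] c; first by move=> x _; exact: cst_continuous.
split=> [x _|v]; first exact: differentiable_cst.
by have -> : 'D_v (cst c : V -> W) = cst 0; [apply/funext => x; rewrite derive_cst|].
Qed.

Lemma Ck_linear V W k (U : set V) (l : {linear V -> W}) :
  continuous l -> Ck k U (l : V -> W).
Proof.
move=> cl; case: k => [|k]; first by move=> x _; exact: cl.
split=> [x _|v]; first exact: linear_differentiable.
have -> : 'D_v (l : V -> W) = cst (l v); last exact: Ck_cst.
by apply/funext => x; rewrite deriveE ?diff_lin//; exact: linear_differentiable.
Qed.

(* The derivative of f along an affine map A with linear part T is again a
   directional derivative of f precomposed with A; no chain rule is needed. *)
Lemma growth_rate_affine V V' W (f : V -> W) (A T : V' -> V) (x v : V') :
  (forall h, A (h *: v + x) = h *: T v + A x) ->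
  (fun h => h^-1 *: (((f \o A) \o shift x) (h *: v) - (f \o A) x)) =
  (fun h => h^-1 *: ((f \o shift (A x)) (h *: T v) - f (A x))).
Proof. by move=> AT; apply/funext => h /=; rewrite AT. Qed.

Lemma derive_affine V V' W (f : V -> W) (A T : V' -> V) (x v : V') :
  (forall h, A (h *: v + x) = h *: T v + A x) ->
  'D_v (f \o A) x = 'D_(T v) f (A x).
Proof. by move=> AT; rewrite /derive (growth_rate_affine _ AT). Qed.

Lemma derivable_affine V V' W (f : V -> W) (A T : V' -> V) (x v : V') :
  (forall h, A (h *: v + x) = h *: T v + A x) ->
  derivable f (A x) (T v) -> derivable (f \o A) x v.
Proof. by move=> AT; rewrite /derivable (growth_rate_affine _ AT). Qed.

Lemma Ck_affine V V' W k (U : set V) (f : V -> W) (A T : V' -> V) :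
  (forall x v h, A (h *: v + x) = h *: T v + A x) ->
  (forall x, differentiable A x) ->
  Ck k U f -> Ck k (A @^-1` U) (f \o A).
Proof.
move=> AT dA; elim: k f => [|k IH] f.
  move=> cf x Ux; apply: continuous_comp; last exact: cf.
  exact/differentiable_continuous/dA.
move=> [df Df]; split=> [x Ux|v].
  by apply: differentiable_comp; [exact: dA|exact: df].
have -> : 'D_v (f \o A) = 'D_(T v) f \o A.
  by apply/funext => x; exact: derive_affine.
by apply: IH; exact: Df.
Qed.

Lemma smooth_on_affine V V' W (U : set V) (f : V -> W) (A T : V' -> V) :
  (forall x v h, A (h *: v + x) = h *: T v + A x) ->
  (forall x, differentiable A x) ->
  smooth_on U f -> smooth_on (A @^-1` U) (f \o A).
Proof. by move=> AT dA sf k; exact: (Ck_affine AT). Qed.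

End CkCalculus.

(** * Primitives off a finite set *)

Section RealAnalysis.
Context {R : realType}.
Implicit Types (P : seq R) (a b : R) (k u : R -> R).
Local Notation mu := (@lebesgue_measure R).

(** Comparing increments of such primitives needs only the mean value theorem. The finite list [P]
    absorbs the points where [k] is a junk value; continuity of [u] on the closed interval carries
    the estimates across them. *)
Definition primitive_off P a b k u : Prop :=
  {within `[a, b], continuous u} /\
  forall t, t \in `]a, b[ -> t \notin P -> is_derive t 1 u (k t).

Lemma primitive_off_sub P a b a' b' k u : a <= a' -> b' <= b ->
  primitive_off P a b k u -> primitive_off P a' b' k u.
Proof.
move=> aa' b'b [cu du]; split.
  by apply: continuous_subspaceW cu; apply: subset_itv; rewrite bnd_simp.
move=> t; rewrite in_itv /= => /andP[a't tb'] tP; apply: du => //.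
by rewrite in_itv /= (le_lt_trans aa' a't) (lt_le_trans tb' b'b).
Qed.

(** Induction on [P]: an exceptional point inside the interval splits it in two, and any other one
    is dropped. *)
Lemma primitive_off_ndecr P a b k u : a <= b -> primitive_off P a b k u ->
  (forall t, t \in `]a, b[ -> t \notin P -> 0 <= k t) -> u a <= u b.
Proof.
elim: P a b => [|p P IH] a b ab [cu du] k0.
  have : {in `[a, b]%R &, {homo u : x y / x <= y}}.
    apply: ger0_derive1_le_cc => // t tab; have [] := du t tab isT => // dt Dt.
    by rewrite derive1E Dt k0.
  by move=> H; apply: H; rewrite ?in_itv /= ?lexx ?ab.
have [pab|npab] := boolP (p \in `]a, b[); last first.
  apply: (IH a b) => //.
    split=> // t tab tP; apply: du => //; rewrite inE negb_or tP andbT.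
    by apply: contra npab => /eqP <-.
  move=> t tab tP; apply: k0 => //; rewrite inE negb_or tP andbT.
  by apply: contra npab => /eqP <-.
move: pab; rewrite in_itv /= => /andP[ap pb].
apply: (@le_trans _ _ (u p)).
  apply: (IH a p); first exact: ltW.
    split; first by apply: continuous_subspaceW cu; apply: subset_itv; rewrite bnd_simp// ltW.
    move=> t; rewrite in_itv /= => /andP[at_ tp] tP; apply: du.
      by rewrite in_itv /= at_ (lt_trans tp).
    by rewrite inE negb_or tP andbT lt_eqF.
  move=> t; rewrite in_itv /= => /andP[at_ tp] tP; apply: k0.
    by rewrite in_itv /= at_ (lt_trans tp).
  by rewrite inE negb_or tP andbT lt_eqF.
apply: (IH p b); first exact: ltW.
  split; first by apply: continuous_subspaceW cu; apply: subset_itv; rewrite bnd_simp// ltW.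
  move=> t; rewrite in_itv /= => /andP[pt tb] tP; apply: du.
    by rewrite in_itv /= tb (lt_trans ap).
  by rewrite inE negb_or tP andbT gt_eqF.
move=> t; rewrite in_itv /= => /andP[pt tb] tP; apply: k0.
  by rewrite in_itv /= tb (lt_trans ap).
by rewrite inE negb_or tP andbT gt_eqF.
Qed.

Lemma primitive_off_le P1 P2 a b k1 k2 u1 u2 : a <= b ->
  primitive_off P1 a b k1 u1 -> primitive_off P2 a b k2 u2 ->
  (forall t, t \in `]a, b[ -> t \notin P1 ++ P2 -> k1 t <= k2 t) ->
  u1 b - u1 a <= u2 b - u2 a.
Proof.
move=> ab [cu1 du1] [cu2 du2] k12.
have : (u2 - u1) a <= (u2 - u1) b.
  apply: (@primitive_off_ndecr (P1 ++ P2) a b (k2 - k1)) => //; last first.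
    by move=> t tab tP; rewrite !fctE subr_ge0 k12.
  split; first by move=> x; apply: continuousD; [exact: cu2|apply: continuousN; exact: cu1].
  move=> t tab tP; have := tP; rewrite mem_cat negb_or => /andP[tP1 tP2].
  by apply: is_deriveB; [exact: du2|exact: du1].
by rewrite !fctE; lra.
Qed.

Lemma primitive_off_eq P1 P2 a b k1 k2 u1 u2 : a <= b ->
  primitive_off P1 a b k1 u1 -> primitive_off P2 a b k2 u2 ->
  (forall t, t \in `]a, b[ -> t \notin P1 ++ P2 -> k1 t = k2 t) ->
  u1 b - u1 a = u2 b - u2 a.
Proof.
move=> ab p1 p2 k12; apply: le_anti; apply/andP; split.
  by apply: (primitive_off_le ab p1 p2) => t tab tP; rewrite k12.
apply: (primitive_off_le ab p2 p1) => t tab tP; rewrite k12//.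
by move: tP; rewrite !mem_cat orbC.
Qed.

(** The primitive is the integral with variable upper bound: integrability gives its continuity, and
    the fundamental theorem of calculus its derivative wherever [k] is continuous. *)
Lemma Rintegral_primitive_off P a b k : a < b ->
  mu.-integrable `[a, b] (EFin \o k) ->
  (forall t, t \in `]a, b[ -> t \notin P -> {for t, continuous k}) ->
  exists2 u, primitive_off P a b k u &
    \int[mu]_(t in `[a, b]%classic) k t = u b - u a.
Proof.
move=> ab ik ck; exists (fun x => \int[mu]_(t in `[a, x]%classic) k t).
  split; first exact: (parameterized_integral_continuous (ltW ab) ik).
  move=> t tab tP; have := tab; rewrite in_itv /= => /andP[at_ tb].
  have [d1 d2] := @continuous_FTC1_closed _ k a t b tb ik at_ (ck _ tab tP).
  by split; [exact: d1|rewrite -derive1E].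
by rewrite set_itv1 Rintegral_set1 subr0.
Qed.

(** A bounded measurable function on a segment is integrable. Agreement with a continuous function
    is asked only inside each piece, so the values at the subdivision points are arbitrary. *)
Lemma integrable_piecewise (f : R -> R) (s : nat -> R) (m : nat) :
  (forall j, (j < m)%N -> s j < s j.+1 /\ exists2 g,
     {within `[s j, s j.+1], continuous g} &
     forall t, t \in `]s j, s j.+1[ -> f t = g t) ->
  mu.-integrable `[s 0%N, s m] (EFin \o f).
Proof.
move=> pf.
suff [smon mf [M bf]] : [/\ s 0%N <= s m, measurable_fun `[s 0%N, s m] f &
    exists M, forall t, t \in `[s 0%N, s m] -> `|f t| <= M].
  apply: measurable_bounded_integrable => //.
    by rewrite /= lebesgue_measure_itv /=; case: ifP => _; rewrite ltry.
  exists M; split; first exact: num_real.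
  by move=> x Mx t tab; apply: (le_trans (bf t tab)); exact: ltW.
elim: m pf => [|m IH] pf.
  split=> //; first by rewrite set_itv1; exact: measurable_fun_set1.
  exists `|f (s 0%N)| => t; rewrite in_itv /= => t0.
  by have /eqP -> : s 0%N == t by rewrite eq_le.
have [|sm mf [M bf]] := IH.
  by move=> j jm; apply: pf; rewrite ltnS ltnW.
have [slt [g cg fg]] := pf m (ltnSn _).
have mg : measurable_fun `[s m, s m.+1] g.
  exact: subspace_continuous_measurable_fun.
have [N bg] : exists N, forall t, t \in `[s m, s m.+1] -> `|g t| <= N.
  have /compact_bounded[N [_ bN]] := continuous_compact cg (@segment_compact _ _ _).
  exists (N + 1) => t tm; apply: (bN (N + 1)); first by rewrite ltrDl.
  by exists t.
have splitE : `[s 0%N, s m.+1]%classic = `[s 0%N, s m]%classic `|` `[s m, s m.+1]%classic.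
  apply/seteqP; split=> t /=; rewrite !in_itv /=.
    by move=> /andP[-> ->]; rewrite andbT; case: (leP t (s m)) => [|/ltW ->]; [left|right].
  case=> /andP[h1 h2]; first by rewrite h1 (le_trans h2)// ltW.
  by rewrite h2 (le_trans sm).
split; first by rewrite (le_trans sm) ?ltW.
  rewrite splitE; apply/measurable_funU => //; split=> //.
  apply: (@measurable_fun_itv_cc _ _ _ false true).
  apply: (eq_measurable_fun g) => [t|].
    by rewrite inE /= => tm; rewrite fg.
  apply: measurable_funS mg => //; exact: subset_itv_oo_cc.
(* [M] bounds [f] up to [s m], [N] bounds it inside the new piece, and the value at [s m.+1], where
   [f] need not agree with [g], is added by hand. *)
exists (Num.max M (Num.max N (Num.max `|f (s m)| `|f (s m.+1)|))) => t.
rewrite in_itv /= => /andP[t0 t1]; rewrite !le_max.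
have [tm|mt] := leP t (s m); first by rewrite bf// in_itv /= t0.
have [->|tne] := eqVneq t (s m.+1); first by rewrite lexx !orbT.
have tlt : t < s m.+1 by rewrite lt_neqAle tne.
by rewrite fg ?bg ?orbT// in_itv /= ?mt ?ltW.
Qed.

End RealAnalysis.

(** * Minkowski norms *)

Section DirectionalDerivatives.
Context {R : realType} {V W : normedModType R}.
Implicit Type f : V -> W.

Lemma derive_line f (a v : V) (t : R) :
  'D_1 (fun h : R => f (h *: v + a)) t = 'D_v f (t *: v + a).
Proof.
have := @derive_affine R V R W f (fun h : R => h *: v + a) (fun h => h *: v) t 1.
by rewrite scale1r; apply=> h; rewrite scalerDl -scalerA scale1r addrA.
Qed.

Lemma derivable_line f (a v : V) (t : R) :
  derivable f (t *: v + a) v -> derivable (fun h : R => f (h *: v + a)) t 1.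
Proof.
have := @derivable_affine R V R W f (fun h : R => h *: v + a) (fun h => h *: v) t 1.
by rewrite scale1r; apply=> h; rewrite scalerDl -scalerA scale1r addrA.
Qed.

Lemma is_derive_line f (a v : V) (t : R) : derivable f (t *: v + a) v ->
  is_derive t 1 (fun h : R => f (h *: v + a)) ('D_v f (t *: v + a)).
Proof. by move=> dv; split; [exact: derivable_line|exact: derive_line]. Qed.

Lemma deriveDr f (x u v : V) : differentiable f x ->
  'D_(u + v) f x = 'D_u f x + 'D_v f x.
Proof. by move=> df; rewrite !deriveE// linearD. Qed.

Lemma deriveZr f (x u : V) (l : R) : differentiable f x ->
  'D_(l *: u) f x = l *: 'D_u f x.
Proof. by move=> df; rewrite !deriveE// linearZ. Qed.

Lemma open_neq0 : open [set y : V | y != 0].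
Proof.
have -> : [set y : V | y != 0] = ~` [set 0].
  by apply/seteqP; split=> y /= /eqP.
by apply/closed_openC/accessible_closed_set1/hausdorff_accessible/norm_hausdorff.
Qed.

Lemma near_neq0 (y : V) : y != 0 -> \forall z \near y, z != 0.
Proof. by move=> y0; apply: open_nbhs_nbhs; split=> //; exact: open_neq0. Qed.

Lemma near_line (P : set V) (y u : V) :
  (\forall z \near y, P z) -> \forall h \near (0 : R), P (h *: u + y).
Proof.
move=> Py; suff : {for 0, continuous (fun h : R => h *: u + y)}.
  by apply; rewrite /= scale0r add0r.
by apply: continuousD; [apply: continuousZr_tmp; exact: cvg_id|exact: cvg_cst].
Qed.

End DirectionalDerivatives.

Lemma near0_gtDr {R : realType} (c : R) : 0 < c -> \forall h \near 0, 0 < h + c.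
Proof.
move=> c0; exists c => //= h; rewrite /ball_ /= sub0r normrN ltr_norml; lra.
Qed.

Section MinkowskiNorm.
Context {R : realType} {V : normedModType R}.

(** Strict convexity is carried by the half square, because the second derivative of [f] itself
    vanishes in the radial direction. *)
Definition minkowski_norm (f : V -> R) : Prop := [/\ forall y, 0 <= f y,
  forall (l : R) y, 0 < l -> f (l *: y) = l * f y,
  Ck 2 [set y | y != 0] f &
  forall y u : V, y != 0 -> u != 0 ->
    0 < 'D_u ('D_u (fun z => 2^-1 * f z ^+ 2)) y].

Variable f : V -> R.
Hypothesis f_hom : forall (l : R) y, 0 < l -> f (l *: y) = l * f y.
Hypothesis f_C2 : Ck 2 [set y : V | y != 0] f.

Let g := fun z => 2^-1 * f z ^+ 2.

Lemma hom_differentiable y : y != 0 -> differentiable f y.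
Proof. by case: f_C2 => df _; exact: df. Qed.

Lemma hom_differentiable2 u y : y != 0 -> differentiable ('D_u f) y.
Proof. by case: f_C2 => _ /(_ u)[df _]; exact: df. Qed.

(** Euler's relation, obtained by differentiating f((1 + h) y) = (1 + h) f(y) at h = 0. *)
Lemma hom_euler y : y != 0 -> 'D_y f y = f y.
Proof.
move=> y0; have := derive_line f y y 0; rewrite scale0r add0r => <-.
rewrite (@near_eq_derive _ _ _ _ ( *:%R^~ (f y) + cst (f y))); last first.
  near=> h; have h1 : 0 < h + 1.
    by near: h; exact: near0_gtDr.
  by rewrite -{2}[y]scale1r -scalerDl f_hom// !fctE /= mulrDl mul1r.
rewrite deriveD// derive_cst addr0 -derive1E.
by rewrite derive1E deriveE// diff_val scale1r.
Unshelve. all: by end_near. Qed.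

(** Both sides of f(c z) = c f(z) are differentiated in the direction [u], and the factor c
    cancels. *)
Lemma hom_derive_scale u y (c : R) : y != 0 -> 0 < c ->
  'D_u f (c *: y) = 'D_u f y.
Proof.
move=> y0 c0; have cy0 : c *: y != 0 by rewrite scaler_eq0 negb_or gt_eqF.
have h1 : 'D_u (f \o ( *:%R c)) y = c * 'D_u f (c *: y).
  rewrite (@derive_affine _ _ _ _ f ( *:%R c) ( *:%R c)).
    by rewrite deriveZr//; exact: hom_differentiable.
  by move=> h; rewrite scalerDr !scalerA mulrC.
have h2 : 'D_u (f \o ( *:%R c)) y = c * 'D_u f y.
  have -> : f \o ( *:%R c) = c *: f by apply/funext => z /=; rewrite f_hom.
  by rewrite deriveZ//; exact/diff_derivable/hom_differentiable.
by apply: (mulfI (lt0r_neq0 c0)); rewrite -h1 -h2.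
Qed.

Lemma hom_derive2_radial u y : y != 0 -> 'D_y ('D_u f) y = 0.
Proof.
move=> y0; have := derive_line ('D_u f) y y 0; rewrite scale0r add0r => <-.
rewrite (@near_eq_derive _ _ _ _ (cst ('D_u f y))) ?derive_cst//.
near=> h; have h1 : 0 < h + 1 by near: h; exact: near0_gtDr.
by rewrite -{2}[y]scale1r -scalerDl hom_derive_scale.
Unshelve. all: by end_near. Qed.

(* By Euler, [f] equals [D_y f + h D_u f] at [h u + y]; differentiating in [h]
   gives the symmetric counterpart of the previous lemma without Schwarz. *)
Lemma hom_derive2_radialC u y : y != 0 -> 'D_u ('D_y f) y = 0.
Proof.
move=> y0; have := derive_line ('D_y f) y u 0; rewrite scale0r add0r => <-.
pose F1 (h : R) := f (h *: u + y).
pose F2 (h : R) := 'D_u f (h *: u + y).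
have dF1 : is_derive (0 : R) 1 F1 ('D_u f y).
  have := @is_derive_line _ _ _ f y u 0; rewrite scale0r add0r; apply.
  exact/diff_derivable/hom_differentiable.
have dF2 : is_derive (0 : R) 1 F2 ('D_u ('D_u f) y).
  have := @is_derive_line _ _ _ ('D_u f) y u 0; rewrite scale0r add0r; apply.
  exact/diff_derivable/hom_differentiable2.
have dF : is_derive (0 : R) 1 (F1 - id * F2) 0.
  have := is_deriveB dF1 (is_deriveM (is_derive_id (0 : R) 1) dF2).
  move=> /is_derive_eq; apply; rewrite /F2 !scale0r !add0r.
  by rewrite -[_%:A]/(_ * 1) mulr1 subrr.
rewrite (@near_eq_derive _ _ _ _ (F1 - id * F2)) ?derive_val//.
near=> h; have z0 : h *: u + y != 0.
  by near: h; exact: near_line (near_neq0 y0).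
have := hom_euler z0; rewrite deriveDr ?deriveZr; try exact: hom_differentiable.
by rewrite !fctE /F1 /F2 => <-; rewrite addrAC subrr add0r.
Unshelve. all: by end_near. Qed.

(** The radial direction lies in the kernel of the second derivative of [f], so a direction may be
    corrected by a multiple of [y]. *)
Lemma hom_derive2_shift u y (s : R) : y != 0 ->
  'D_(u + s *: y) ('D_(u + s *: y) f) y = 'D_u ('D_u f) y.
Proof.
move=> y0; rewrite deriveDr ?deriveZr; try exact: hom_differentiable2.
rewrite hom_derive2_radial// scaler0 addr0.
rewrite (@near_eq_derive _ _ _ _ ('D_u f + s *: 'D_y f)); last first.
  near=> z; have z0 : z != 0 by near: z; exact: near_neq0.
  by rewrite deriveDr ?deriveZr//; exact: hom_differentiable.
have d1 : derivable ('D_u f) y u by exact/diff_derivable/hom_differentiable2.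
have d2 : derivable ('D_y f) y u by exact/diff_derivable/hom_differentiable2.
rewrite (deriveD d1 (@derivableZ _ _ _ _ s _ _ d2)).
by rewrite (@deriveZ _ _ _ _ s _ _ d2) (hom_derive2_radialC _ y0) scaler0 addr0.
Unshelve. all: by end_near. Qed.

Lemma hom_energy_derive u y : y != 0 -> 'D_u g y = f y * 'D_u f y.
Proof.
move=> y0; have df : derivable f y u by exact/diff_derivable/hom_differentiable.
rewrite -[g]/(2^-1 *: f ^+ 2) deriveZ; last exact: derivableX.
by rewrite (deriveX 2 df) /= scalerA expr1 mulrA mulVf// mul1r.
Qed.

Lemma hom_energy_derivable2 u y : y != 0 -> derivable ('D_u g) y u.
Proof.
move=> y0; apply: (@near_eq_derivable _ _ _ (f * 'D_u f)).
  near=> z; rewrite hom_energy_derive//; near: z; exact: near_neq0.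
apply: derivableM; apply: diff_derivable.
  exact: hom_differentiable.
exact: hom_differentiable2.
Unshelve. all: by end_near. Qed.

Lemma hom_energy_derive2 u y : y != 0 ->
  'D_u ('D_u g) y = 'D_u f y ^+ 2 + f y * 'D_u ('D_u f) y.
Proof.
move=> y0; have df : derivable f y u by exact/diff_derivable/hom_differentiable.
have ddf : derivable ('D_u f) y u by exact/diff_derivable/hom_differentiable2.
rewrite (@near_eq_derive _ _ _ _ (f * 'D_u f)).
  by rewrite (deriveM df ddf) [LHS]addrC; congr (_ + _); rewrite expr2.
near=> z; rewrite hom_energy_derive//; near: z; exact: near_neq0.
Unshelve. all: by end_near. Qed.

End MinkowskiNorm.

(** * Consequences of strict convexity *)

Section MinkowskiConvexity.
Context {R : realType} {V : normedModType R}.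
Implicit Types (f : V -> R) (y u w : V).

(** By Euler's relation the Hessian of the half square at [y], taken in the direction [y], is
    f(y)^2. *)
Lemma minkowski_gt0 f y : minkowski_norm f -> y != 0 -> 0 < f y.
Proof.
move=> [f0 fh f2 fconv] y0; have := fconv y y y0 y0.
rewrite (hom_energy_derive2 f2)// (hom_derive2_radial fh f2)// mulr0 addr0.
rewrite (hom_euler fh)// => fy; rewrite lt_neqAle f0 andbT eq_sym.
by apply: contraTneq fy => ->; rewrite expr0n ltxx.
Qed.

(** The fundamental inequality of Finsler geometry. For f(v) = f(y) the half square has equal values
    at both ends of the segment from [y] to [v] and is strictly convex along it, so it decreases at
    [y]; Euler's relation turns this into a bound on [D_v f y]. *)
Lemma minkowski_support f y w : minkowski_norm f -> y != 0 -> 'D_w f y <= f w.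
Proof.
move=> mf y0; have [f0 fh f2 fconv] := mf.
have dfy : differentiable f y by exact: hom_differentiable f2 _ y0.
have [->|w0] := eqVneq w 0; first by rewrite derive0.
have fy := minkowski_gt0 mf y0; have fw := minkowski_gt0 mf w0.
(* It is enough to bound [D_v f y] for the multiple [v] of [w] with [f v = f y]. *)
pose c := f y / f w; have c0 : 0 < c by rewrite divr_gt0.
have [v [v0 fv Dv]] : exists v, [/\ v != 0, f v = f y & 'D_v f y = c * 'D_w f y].
  exists (c *: w); rewrite scaler_eq0 negb_or gt_eqF// w0.
  by rewrite fh// deriveZr// /c -mulrA mulVf ?mulr1 ?gt_eqF.
suff Dvy : 'D_v f y <= f y.
  by rewrite -(ler_pM2l c0) -Dv /c -mulrA mulVf ?mulr1// gt_eqF.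
pose g z := 2^-1 * f z ^+ 2.
(* A segment through the origin leaves the domain of smoothness. Then [v] is a nonpositive multiple
   of [y], and Euler's relation gives the bound directly. *)
have [[t [t0 t1 tz]]|seg] :=
    pselect (exists t : R, [/\ 0 <= t, t <= 1 & t *: (v - y) + y = 0]).
  have tn0 : 0 < t.
    rewrite lt_neqAle t0 andbT eq_sym; apply: contra_neq y0 => tE.
    by move: tz; rewrite tE scale0r add0r.
  have tv : t *: v = (t - 1) *: y.
    rewrite scalerBl scale1r; apply/eqP; rewrite -subr_eq0 -[X in _ == X]tz.
    by rewrite scalerBr opprB addrA addrAC.
  have -> : v = ((1 - t) / t) *: (- y).
    by rewrite scalerN -scaleNr -mulNr opprB mulrC -scalerA -tv scalerA mulVf ?gt_eqF// scale1r.
  have -> : 'D_(((1 - t) / t) *: (- y)) f y = ((1 - t) / t) * (- f y).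
    by rewrite deriveZr// -[- y]scaleN1r deriveZr// (hom_euler fh)// scaleN1r.
  rewrite (le_trans _ (f0 y))//.
  by rewrite mulr_ge0_le0 ?oppr_le0// divr_ge0// subr_ge0.
set u := v - y in seg.
have [u0|un0] := eqVneq u 0.
  by rewrite (subr0_eq u0) (hom_euler fh).
have sn0 (t : R) : 0 <= t -> t <= 1 -> t *: u + y != 0.
  by move=> t0 t1; apply/eqP => tz; apply: seg; exists t.
have dg1 (t : R) : 0 <= t -> t <= 1 ->
    is_derive t 1 (fun h : R => g (h *: u + y)) ('D_u g (t *: u + y)).
  move=> t0 t1; apply: (@is_derive_line _ _ _ g).
  rewrite -[g]/(2^-1 *: f ^+ 2); apply: derivableZ; apply: derivableX.
  exact/diff_derivable/(hom_differentiable f2)/sn0.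
have dg2 (t : R) : 0 <= t -> t <= 1 ->
    is_derive t 1 (fun h : R => 'D_u g (h *: u + y)) ('D_u ('D_u g) (t *: u + y)).
  move=> t0 t1; apply: (@is_derive_line _ _ _ ('D_u g)).
  by apply: (hom_energy_derivable2 f2); exact: sn0.
(* The end values of the half square agree, so its derivative along the segment vanishes at [c1]. *)
have [] := @MVT R (fun h => g (h *: u + y)) (fun t => 'D_u g (t *: u + y)) 0 1 ltr01.
- by move=> t; rewrite in_itv /= => /andP[/ltW t0 /ltW t1]; exact: dg1.
- apply: derivable_within_continuous => t; rewrite in_itv /= => /andP[t0 t1].
  by have [] := dg1 t t0 t1.
move=> c1; rewrite in_itv /= => /andP[c10 c11].
rewrite subr0 mulr1 scale1r scale0r add0r /u subrK -/u => gE.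
(* The second derivative is positive, so the first one, which is zero at [c1], is negative at
   [y]. *)
have [] := @MVT R (fun h => 'D_u g (h *: u + y)) (fun t => 'D_u ('D_u g) (t *: u + y)) 0 c1 c10.
- move=> t; rewrite in_itv /= => /andP[/ltW t0 tc]; apply: dg2 => //.
  by rewrite (le_trans (ltW tc))// ltW.
- apply: derivable_within_continuous => t; rewrite in_itv /= => /andP[t0 tc].
  by have [] := dg2 t t0 (le_trans tc (ltW c11)).
move=> c2; rewrite in_itv /= => /andP[c20 c21]; rewrite subr0 scale0r add0r => DE.
have : 0 < 'D_u ('D_u g) (c2 *: u + y) * c1.
  apply: mulr_gt0 => //; apply: fconv => //; apply: sn0; first exact: ltW.
  by rewrite (le_trans (ltW c21))// ltW.
rewrite -DE -gE /g fv subrr sub0r oppr_gt0 (hom_energy_derive f2)//.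
rewrite pmulr_rlt0// /u deriveDr// -scaleN1r deriveZr// (hom_euler fh)//.
by rewrite scaleN1r subr_lt0 => /ltW.
Qed.

(* Subtracting a linear form leaves [D_u D_u f] unchanged, and this quantity is
   positive unless [u] is radial, in which case [D_u f] does not vanish. *)
Lemma minkowski_sub_linear f (l : {linear V -> R}) : continuous l ->
  minkowski_norm f -> (forall y, y != 0 -> 0 < f y - l y) ->
  minkowski_norm (fun y => f y - l y).
Proof.
move=> cl mf fl0; have [f0 fh f2 fconv] := mf.
have dl x : differentiable l x by exact: linear_differentiable.
have Dl u x : 'D_u l x = l u by rewrite deriveE// diff_lin.
set f1 := fun y => f y - l y.
have f1h (a : R) y : 0 < a -> f1 (a *: y) = a * f1 y.
  by move=> a0; rewrite /f1 fh// linearZ mulrBr.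
have f12 : Ck 2 [set y | y != 0] f1.
  have -> : f1 = f + (-1) *: (l : V -> R).
    by apply/funext => y; rewrite !fctE scaleN1r.
  have l2 : Ck 2 [set y : V | y != 0] (l : V -> R) by exact: Ck_linear.
  exact: (CkD open_neq0 f2 (CkZ (-1) open_neq0 l2)).
split; [move=> y|exact: f1h|exact: f12|move=> y u y0 u0].
  by have [->|/fl0/ltW//] := eqVneq y 0; rewrite /f1 /= linear0 subr0 f0.
rewrite (hom_energy_derive2 f12 u y0).
have Df1 x w : x != 0 -> 'D_w f1 x = 'D_w f x - l w.
  move=> x0; rewrite (@deriveB _ _ _ f l) ?Dl//; apply: diff_derivable => //.
  exact: hom_differentiable f2 _ x0.
have -> : 'D_u ('D_u f1) y = 'D_u ('D_u f) y.
  rewrite (@near_eq_derive _ _ _ _ ('D_u f - cst (l u))).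
    rewrite deriveB ?derive_cst ?subr0//.
    exact/diff_derivable/(hom_differentiable2 f2).
  near=> z; rewrite Df1//; near: z; exact: near_neq0.
have fy := minkowski_gt0 mf y0; have f1y := fl0 y y0.
have dfy : differentiable f y by exact: hom_differentiable f2 _ y0.
(* With this [s] the derivative of [f] at [y] in the direction [u + s *: y] is 0, so the Hessian of
   the half square in that direction reduces to f(y) times the second derivative of [f], which the
   shift does not change. *)
pose s := - 'D_u f y / f y.
have Ds : 'D_(u + s *: y) f y = 0.
  by rewrite deriveDr// deriveZr// (hom_euler fh)// /s -[_ *: _]/(_ * _) divfK ?gt_eqF// subrr.
(* In the radial case [D_u f1 y] equals - s f1(y), which is nonzero, and its square alone gives
   positivity. *)
have [us0|us0] := eqVneq (u + s *: y) 0.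
  have uE : u = (- s) *: y by rewrite scaleNr; apply/eqP; rewrite -addr_eq0; exact/eqP.
  have s0 : s != 0 by apply: contra_neq u0 => s0; rewrite uE s0 oppr0 scale0r.
  have -> : 'D_u ('D_u f) y = 0.
    by rewrite -(hom_derive2_shift fh f2 u s y0) us0 derive0.
  rewrite mulr0 addr0 uE deriveZr; last exact: hom_differentiable f12 _ y0.
  rewrite (hom_euler f1h)// exprn_even_gt0//=.
  by rewrite -[_ *: _]/(_ * _) mulf_neq0// ?oppr_eq0// gt_eqF.
have := fconv y _ y0 us0; rewrite (hom_energy_derive2 f2 _ y0) Ds expr0n /= add0r.
rewrite (hom_derive2_shift fh f2 u s y0) (pmulr_rgt0 _ fy) => Duu.
by apply: ltr_wpDl; [exact: sqr_ge0|exact: mulr_gt0].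
Unshelve. all: by end_near. Qed.

End MinkowskiConvexity.

(** * Finsler metrics in charts *)

(** Compactness of the unit sphere merges estimates around each direction into a single one for all
    directions; homogeneity then extends it to all vectors. *)
Lemma near_unit_sphere {R : realType} (n : nat) (T : Type) (F : set_system T)
    (P : T -> 'rV[R]_n -> Prop) {FF : Filter F} :
  (forall y, `|y| = 1 -> \forall y' \near y & i \near F, P i y') ->
  \forall i \near F, forall y, `|y| = 1 -> P i y.
Proof.
apply: (@compact_near_coveringP _ [set y : 'rV[R]_n | `|y| = 1]).1.
apply: bounded_closed_compact.
  exists 1; split; first exact: num_real.
  by move=> x x1 y /= ->; exact: ltW.
have -> : [set y : 'rV[R]_n | `|y| = 1] = (fun y : 'rV[R]_n => `|y|) @^-1` [set 1] by [].
apply: closed_comp; first by move=> y _; exact: norm_continuous.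
by apply/accessible_closed_set1/hausdorff_accessible/norm_hausdorff.
Qed.

Section FinslerBasics.
Variables (R : realType) (n : nat) (M : manifold R n).
Local Notation dom i := (cdom (@atlas R n M i)).
Local Notation phi i := (ccoord (@atlas R n M i)).
Local Notation psi i := (cinv (@atlas R n M i)).
Implicit Types (F : finsler_metric M) (i : Defs.index M).

Lemma cimg_ccoord i p : dom i p -> cimg (atlas i) (phi i p).
Proof. by exists p. Qed.

Lemma ccoord_cinv i x : cimg (atlas i) x -> phi i (psi i x) = x.
Proof. by move=> [p ip <-]; rewrite ccoordK. Qed.

Lemma cdom_cinv i x : cimg (atlas i) x -> dom i (psi i x).
Proof. by move=> [p ip <-]; rewrite ccoordK. Qed.

Lemma near_cimg i x : cimg (atlas i) x -> \forall z \near x, cimg (atlas i) z.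
Proof. by move=> ix; apply: open_nbhs_nbhs; split=> //; exact: cimg_open. Qed.

Lemma tvec_linear i p : linear (@tvec R n M i p).
Proof.
move=> a u v; apply: val_inj; apply/funext => j; rewrite /= /tvec_family.
rewrite addrfctE scalrfctE.
by case: ifP => _; [rewrite linearP|rewrite scaler0 addr0].
Qed.

HB.instance Definition _ i p :=
  GRing.isLinear.Build R 'rV[R]_n (tangent p) _ (@tvec R n M i p) (@tvec_linear i p).

Lemma tvecZ i p a (y : 'rV[R]_n) : tvec i p (a *: y) = a *: tvec i p y.
Proof. exact: linearZ. Qed.

Lemma tvecN i p (y : 'rV[R]_n) : tvec i p (- y) = - tvec i p y.
Proof. exact: linearN. Qed.

Lemma tvec_eq0 i p (y : 'rV[R]_n) : dom i p -> (tvec i p y == 0) = (y == 0).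
Proof.
move=> ip; apply/eqP/eqP => [y0|->]; last exact: linear0.
by rewrite -(tvecK y ip) y0.
Qed.

Lemma finsler0 F p : F p 0 = 0.
Proof.
have := finsler_homogeneous F (0 : tangent p) (l := 2) ltac:(by []).
by rewrite scaler0; lra.
Qed.

Lemma local_exprE F i p (y : 'rV[R]_n) : dom i p ->
  F p (tvec i p y) = local_expr F i (phi i p, y).
Proof. by move=> ip; rewrite /local_expr /= ccoordK. Qed.

Lemma local_exprZ F i x (a : R) (y : 'rV[R]_n) : 0 < a ->
  local_expr F i (x, a *: y) = a * local_expr F i (x, y).
Proof. by move=> a0; rewrite /local_expr /= tvecZ finsler_homogeneous. Qed.

Lemma local_expr0 F i x : local_expr F i (x, 0) = 0.
Proof. by rewrite /local_expr /= linear0 finsler0. Qed.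

Lemma local_expr_ge0 F i z : 0 <= local_expr F i z.
Proof. exact: finsler_ge0. Qed.

Lemma open_slit i : open [set z : 'rV[R]_n * 'rV[R]_n | cimg (@atlas R n M i) z.1 /\ z.2 != 0].
Proof.
have -> : [set z : 'rV[R]_n * 'rV[R]_n | cimg (@atlas R n M i) z.1 /\ z.2 != 0] =
  (fst @^-1` cimg (@atlas R n M i)) `&` (snd @^-1` [set y | y != 0]) by [].
apply: openI; apply: open_comp.
- by move=> z _; exact: cvg_fst.
- exact: cimg_open.
- by move=> z _; exact: cvg_snd.
- exact: open_neq0.
Qed.

Lemma smooth_fibre F i p : dom i p ->
  smooth_on [set y | y != 0] (fun y => F p (tvec i p y)).
Proof.
move=> ip; have -> : (fun y => F p (tvec i p y)) =
    local_expr F i \o (fun y => (phi i p, y)).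
  by apply/funext => y /=; rewrite local_exprE.
apply: smooth_on_subset (smooth_on_affine (T := fun v => (0, v)) _ _ (@finsler_smooth _ _ _ F i)).
- by move=> y y0; split=> //=; exact: cimg_ccoord.
- by move=> y v h; rewrite -[h *: (0, v)]/(h *: 0, h *: v) -[_ + (_, _)]/(_ + _, _ + _)
    scaler0 add0r.
- by move=> y; exact: differentiable_pair.
Qed.

Lemma minkowski_fibre F i p : dom i p -> minkowski_norm (fun y => F p (tvec i p y)).
Proof.
move=> ip; split=> [y|l y l0||y u y0 u0].
- exact: finsler_ge0.
- by rewrite tvecZ finsler_homogeneous.
- exact: smooth_fibre.
- exact: finsler_convex.
Qed.

Lemma finsler_gt0 F p (v : tangent p) : v != 0 -> 0 < F p v.
Proof.
move=> v0; have ip := projT2 (cid (atlas_cover p)).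
rewrite -(tcoordK v ip) in v0 *.
apply: (minkowski_gt0 (minkowski_fibre F ip)).
by apply: contra_neq v0 => ->; exact: linear0.
Qed.

Lemma local_expr_gt0 F i x (y : 'rV[R]_n) : cimg (atlas i) x -> y != 0 ->
  0 < local_expr F i (x, y).
Proof.
by move=> ix y0; apply: finsler_gt0; rewrite tvec_eq0//; exact: cdom_cinv.
Qed.

Lemma local_expr_continuous_neq0 F i x (y : 'rV[R]_n) : cimg (atlas i) x -> y != 0 ->
  {for (x, y), continuous (local_expr F i)}.
Proof.
by move=> ix y0; apply: (finsler_smooth F i 0%N).
Qed.

Lemma unit_vector (y : 'rV[R]_n) : y != 0 -> `| `|y|^-1 *: y| = 1.
Proof. by move=> y0; rewrite normrZ normfV normr_id mulVf// normr_eq0. Qed.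

Lemma local_expr_unit F i x (y : 'rV[R]_n) : y != 0 ->
  local_expr F i (x, y) = `|y| * local_expr F i (x, `|y|^-1 *: y).
Proof.
move=> y0; rewrite -local_exprZ ?normr_gt0//.
by rewrite scalerA mulfV ?scale1r// normr_eq0.
Qed.

Lemma near_local_expr F i x (y : 'rV[R]_n) (d : R) : cimg (atlas i) x -> y != 0 ->
  0 < d -> \forall y' \near y & x' \near x,
    `|local_expr F i (x, y) - local_expr F i (x', y')| < d.
Proof.
move=> ix y0 d0; have := local_expr_continuous_neq0 (F := F) ix y0.
move=> /cvgrPdist_lt /(_ _ d0) [[A B] /= [Ax By] AB].
by exists (B, A) => //= -[y' x'] [By' Ax']; exact: (AB (x', y')).
Qed.

Lemma unit_neq0 (y : 'rV[R]_n) : `|y| = 1 -> y != 0.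
Proof. by move=> y1; rewrite -normr_eq0 y1 oner_eq0. Qed.

Lemma local_expr_bounds F i x : cimg (atlas i) x ->
  exists c C : R, [/\ 0 < c, 0 < C & \forall x' \near x,
    forall y, c * `|y| <= local_expr F i (x', y) <= C * `|y|].
Proof.
move=> ix.
(* The second component of [r] serves both as the lower constant and as the inverse of the upper
   one, so that the compactness argument runs over a single filter. *)
have : \forall r \near (nbhs x, (0 : R)^'+), forall y : 'rV[R]_n, `|y| = 1 ->
    r.2 <= local_expr F i (r.1, y) <= r.2^-1.
  apply: (@near_unit_sphere _ _ _ (filter_prod (nbhs x) (0 : R)^'+)
    (fun r y => is_true (r.2 <= local_expr F i (r.1, y) <= r.2^-1))) => y y1; have y0 := unit_neq0 y1.
  set l := local_expr F i (x, y); have l0 : 0 < l by exact: local_expr_gt0.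
  have l20 : 0 < l / 2 by rewrite divr_gt0.
  have [[A B] /= [yA xB] AB] := near_local_expr F ix y0 l20.
  exists (A, [set r | B r.1 /\ (r.2 <= l / 2 /\ 0 < r.2 <= (2 * l)^-1)]).
    split=> //=; exists (B, [set r | r <= l / 2 /\ 0 < r <= (2 * l)^-1]) => //=.
    split=> //; near=> r; split; first by near: r; exact: nbhs_right_le.
    apply/andP; split; first by near: r; exact: nbhs_right_gt.
    by near: r; apply: nbhs_right_le; rewrite invr_gt0 mulr_gt0.
  move=> [y' [x' r]] /= [Ay' [Bx' [rl /andP[r0 rl']]]].
  have := AB (y', x') (conj Ay' Bx'); rewrite -/l /= ltr_distlC => /andP[l1 l2].
  apply/andP; split; first by apply: (le_trans rl); lra.
  rewrite -[leLHS]invrK lef_pV2 ?posrE ?invr_gt0//; last by lra.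
  by apply: (le_trans rl'); rewrite lef_pV2 ?posrE; lra.
move=> [[A B] /= [xA B0] AB].
have [c [Bc c0]] : exists c : R, B c /\ 0 < c.
  have /filter_ex[c] : \forall c \near (0 : R)^'+, B c /\ 0 < c.
    by apply: filterI => //; exact: nbhs_right_gt.
  by exists c.
exists c, c^-1; split=> //; first by rewrite invr_gt0.
apply: filterS xA => x' Ax' y; have [->|y0] := eqVneq y 0.
  by rewrite local_expr0 normr0 !mulr0 lexx.
have /andP[h1 h2] := AB (x', c) (conj Ax' Bc) _ (unit_vector y0).
by rewrite (local_expr_unit F i x' y0) !(mulrC _ `|y|) !ler_pM2l ?normr_gt0// h1 h2.
Unshelve. all: by end_near. Qed.

Lemma local_expr_near F i x (e : R) : cimg (atlas i) x -> 0 < e ->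
  \forall x' \near x, forall y : 'rV[R]_n,
    (1 - e) * local_expr F i (x, y) <= local_expr F i (x', y) <=
    (1 + e) * local_expr F i (x, y).
Proof.
move=> ix e0.
have H : \forall x' \near x, forall y : 'rV[R]_n, `|y| = 1 ->
    (1 - e) * local_expr F i (x, y) <= local_expr F i (x', y) <=
    (1 + e) * local_expr F i (x, y).
  apply: (@near_unit_sphere _ _ _ (nbhs x) (fun x' y => is_true
    ((1 - e) * local_expr F i (x, y) <= local_expr F i (x', y) <=
     (1 + e) * local_expr F i (x, y)))) => y y1; have y0 := unit_neq0 y1.
  set l := local_expr F i (x, y); have l0 : 0 < l by exact: local_expr_gt0.
  (* The values at (x', y') and (x, y') both lie within [d] of [l], hence within 2 d of each other.
     This must be at most e times the value at (x, y'), which exceeds l - d; so 2 d + e d <= e l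
     suffices, and [d] solves 3 d + e d = e l. *)
  pose d := e * l / (3 + e); have d0 : 0 < d by rewrite divr_gt0 ?mulr_gt0// addr_gt0.
  have dE : 3 * d + e * d = e * l by rewrite /d; field; lra.
  have [[A B] /= [yA xB] AB] := near_local_expr F ix y0 d0.
  exists (A, B) => // -[y' x'] /= [Ay' Bx'].
  have := AB (y', x') (conj Ay' Bx'); rewrite -/l /= ltr_distlC => /andP[l1 l2].
  have := AB (y', x) (conj Ay' (nbhs_singleton xB)).
  rewrite -/l /= ltr_distlC => /andP[l3 l4].
  have ed : 0 < e * d by rewrite mulr_gt0.
  have h1 : e * local_expr F i (x, y') > e * (l - d) by rewrite ltr_pM2l.
  by rewrite mulrBl mulrDl mul1r; apply/andP; split; lra.
apply: filterS H => x' H y; have [->|y0] := eqVneq y 0.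
  by rewrite !local_expr0 !mulr0 lexx.
have /andP[h1 h2] := H _ (unit_vector y0).
rewrite (local_expr_unit F i x' y0) (local_expr_unit F i x y0).
by rewrite 2!(mulrCA _ `|y|) !ler_pM2l ?normr_gt0// h1 h2.
Qed.

(** On the zero section the bound C |y|, uniform in nearby base points, replaces smoothness. The
    speed is thus continuous also where the velocity vanishes. *)
Lemma local_expr_continuous F i x (y : 'rV[R]_n) : cimg (atlas i) x ->
  {for (x, y), continuous (local_expr F i)}.
Proof.
move=> ix; have [->|] := eqVneq y 0; last exact: local_expr_continuous_neq0.
apply/cvgrPdist_le => e e0; rewrite local_expr0.
have [c [C [_ C0 H]]] := local_expr_bounds F ix.
have y0 : \forall y \near (0 : 'rV[R]_n), `|y| <= e / C.
  by apply: nbhs0_le; rewrite divr_gt0.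
exists ([set x | forall y, c * `|y| <= local_expr F i (x, y) <= C * `|y|],
  [set y | `|y| <= e / C]) => //= -[x' y'] /= [/(_ y')/andP[_ h] h2].
rewrite sub0r normrN ger0_norm ?local_expr_ge0// (le_trans h)//.
by rewrite mulrC -ler_pdivlMr.
Qed.

End FinslerBasics.

(** * Speed and length of curves *)

Section Curves.
Variables (R : realType) (n : nat) (M : manifold R n).
Local Notation dom i := (cdom (@atlas R n M i)).
Local Notation phi i := (ccoord (@atlas R n M i)).
Local Notation psi i := (cinv (@atlas R n M i)).
Local Notation tau i j := (transition (@atlas R n M i) (@atlas R n M j)).
Implicit Types (F : finsler_metric M) (i : Defs.index M) (g h : R -> M).

Lemma tvec_change i j p (y : 'rV[R]_n) : dom i p -> dom j p ->
  tvec j p ('d (tau i j) (phi i p) y) = tvec i p y.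
Proof.
move=> ip jp; apply: val_inj; apply/funext => k /=.
have [kp|nkp] := pselect (dom k p).
  rewrite (tvec_familyE _ jp kp) (tvec_familyE _ ip kp).
  exact: transition_cocycle.
have nkp' (l : Defs.index M) : ~ (dom l p /\ dom k p) by case.
by rewrite (tvec_family0 _ (nkp' j)) (tvec_family0 _ (nkp' i)).
Qed.

(** Continuity of [g] is a separate requirement: chart coordinates are arbitrary outside the chart
    domain, so differentiability of the coordinate expression does not keep [g] in that domain near
    [t]. *)
Definition regular_at g t : Prop := {for t, continuous g} /\
  forall i, dom i (g t) -> differentiable (phi i \o g) t.

Lemma regular_near_dom i g t : regular_at g t -> dom i (g t) ->
  \forall t' \near t, dom i (g t').
Proof. by move=> [cg _] it; apply: cg; exact: cdom_nbhs. Qed.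

Lemma velocity_chart i g t : regular_at g t -> dom i (g t) ->
  velocity g t = tvec i (g t) (derive1 (phi i \o g) t).
Proof.
move=> rg it; have jt := projT2 (cid (atlas_cover (g t))).
rewrite /velocity -/(chart_at (g t)) in jt *; set j := chart_at (g t) in jt *.
rewrite -(tvec_change _ jt it) !derive1E'; [|exact: rg.2|exact: rg.2].
congr (tvec i _ _); apply: diff_chain => //; [exact: rg.2| |exact: rg.2|].
  exact: transition_differentiable.
near=> t'; rewrite /transition /= ccoordK//.
by near: t'; exact: regular_near_dom.
Unshelve. all: by end_near. Qed.

Definition speed F g t : R := F (g t) (velocity g t).

Lemma speed_ge0 F g t : 0 <= speed F g t.
Proof. exact: finsler_ge0. Qed.

Lemma speed_chart F i g t : regular_at g t -> dom i (g t) ->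
  speed F g t = local_expr F i (phi i (g t), derive1 (phi i \o g) t).
Proof. by move=> rg it; rewrite /speed (velocity_chart rg it) local_exprE. Qed.

Lemma near_speed F g h t : (\forall t' \near t, g t' = h t') ->
  speed F g t = speed F h t.
Proof.
move=> gh; rewrite /speed /velocity.
have -> : derive1 (phi (chart_at (g t)) \o g) t = derive1 (phi (chart_at (g t)) \o h) t.
  rewrite !derive1E; apply: near_eq_derive.
  by apply: filterS gh => t' /= ->.
by rewrite (nbhs_singleton gh).
Qed.

Lemma near_regular g h t : (\forall t' \near t, g t' = h t') ->
  regular_at g t -> regular_at h t.
Proof.
move=> gh [cg dg]; have ght := nbhs_singleton gh; split.
  rewrite /prop_for /continuous_at -ght; apply: cvg_trans cg.
  by apply: near_eq_cvg; apply: filterS gh.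
move=> i it; apply: near_eq_differentiable (dg i _); last by rewrite ght.
by apply: filterS gh => t' /= ->.
Qed.

Lemma smooth_curve_regular (A : set R) h t : smooth_curve_on A h -> A t ->
  regular_at h t.
Proof.
move=> [ch sh] At; split=> [|i it]; first exact: ch.
exact: smooth_on_differentiable (sh i) _.
Qed.

(** The chart chosen by [velocity] may jump along the curve, so a single chart around [h t] is fixed
    and the speed is expressed in it near [t]. *)
Lemma smooth_curve_speed_continuous F (A : set R) h t : open A ->
  smooth_curve_on A h -> A t -> {for t, continuous (speed F h)}.
Proof.
move=> oA sh At; have rh t' : A t' -> regular_at h t' by exact: smooth_curve_regular.
have it := projT2 (cid (atlas_cover (h t))).
set i := projT1 _ in it.
have nA : \forall t' \near t, A t' /\ dom i (h t').
  by apply: filterI; [exact: open_nbhs_nbhs|exact: regular_near_dom (rh _ At) it].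
have dE : (derive1 (phi i \o h)) = 'D_1 (phi i \o h) by apply/funext => t'; rewrite derive1E.
have c1 : {for t, continuous (phi i \o h)}.
  exact/differentiable_continuous/(rh _ At).2.
have c2 : {for t, continuous (derive1 (phi i \o h))}.
  have := @smooth_on_derive _ _ _ _ _ (1 : R) (sh.2 i) 0%N t.
  by rewrite dE; apply; split.
have c3 : {for t, continuous (fun t' => (phi i (h t'), (derive1 (phi i \o h)) t'))}.
  exact: cvg_pair c1 c2.
have c4 : {for t, continuous (fun t' => local_expr F i (phi i (h t'), (derive1 (phi i \o h)) t'))}.
  apply: (@continuous_comp _ _ _ (fun t' => (phi i (h t'), (derive1 (phi i \o h)) t')) (local_expr F i)) => //.
  by apply: local_expr_continuous; exact: cimg_ccoord.
rewrite /prop_for /continuous_at (speed_chart F (rh _ At) it).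
apply: cvg_trans c4; apply: near_eq_cvg; apply: filterS nA => t' [At' it'].
by rewrite (speed_chart F (rh _ At') it').
Qed.

Lemma subdivision_locate (s : nat -> R) k t : s 0%N < t -> t < s k ->
  t \notin [seq s j | j <- iota 0 k] ->
  exists2 j : nat, (j < k)%N & s j < t < s j.+1.
Proof.
elim: k => [|k IH] t0 tk; first by move: (lt_trans t0 tk); rewrite ltxx.
rewrite -addn1 iotaD map_cat mem_cat negb_or /= add0n inE => /andP[tP tsk].
have [tk'|kt|te] := ltgtP t (s k); last by rewrite te eqxx in tsk.
  by have [j jk jt] := IH t0 tk' tP; exists j; rewrite // addn1 ltnW.
by exists k; rewrite ?addn1// kt.
Qed.

(** Later comparisons of lengths rest on these data alone; the integral enters only through
    [lp_length]. *)
Record length_primitive F (a b : R) g (P : seq R) (u : R -> R) : Prop := {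
  lp_le : a <= b;
  lp_continuous : {within `[a, b], continuous g};
  lp_regular : forall t, t \in `]a, b[ -> t \notin P -> regular_at g t;
  lp_primitive : primitive_off P a b (speed F g) u;
  lp_length : curve_length F a b g = u b - u a
}.

Lemma piecewise_smooth_continuous (a b : R) g : piecewise_smooth a b g ->
  a <= b /\ {within `[a, b], continuous g}.
Proof.
move=> [k [s [<- <-]]]; elim: k => [|k IH] pg.
  by split=> //; rewrite set_itv1; exact: continuous_subspace1.
have [|sk cg] := IH; first by move=> j jk; apply: pg; rewrite ltnS ltnW.
have [slt [A [h [oA [ch _] gh]]]] := pg k (ltnSn _).
split; first by rewrite (le_trans sk)// ltW.
have -> : `[s 0%N, s k.+1]%classic = `[s 0%N, s k]%classic `|` `[s k, s k.+1]%classic.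
  apply/seteqP; split=> t /=; rewrite !in_itv /=.
    by move=> /andP[-> ->]; rewrite andbT; case: (leP t (s k)) => [|/ltW ->]; [left|right].
  case=> /andP[h1 h2]; first by rewrite h1 (le_trans h2)// ltW.
  by rewrite h2 (le_trans sk).
apply: withinU_continuous cg _; [exact: itv_closed|exact: itv_closed|].
have hg : {in `[s k, s k.+1]%classic, h =1 g}.
  by move=> t; rewrite inE /= in_itv /= => /gh[_ ->].
apply: (subspace_eq_continuous hg).
apply: continuous_in_subspaceT => t; rewrite inE /= in_itv /= => /gh[At _].
exact: ch.
Qed.

(** The exceptional list consists of subdivision points. Elsewhere [g] agrees near [t] with a smooth
    curve, from which it inherits regularity and continuity of the speed. *)
Lemma length_primitiveP F (a b : R) g : a < b -> piecewise_smooth a b g ->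
  exists P u, length_primitive F a b g P u.
Proof.
move=> ab pg; have [_ cg] := piecewise_smooth_continuous pg.
have [k [s [s0 sk ps]]] := pg; pose P := [seq s j | j <- iota 0 k].
have loc t : t \in `]a, b[ -> t \notin P -> exists A h,
    [/\ open A, smooth_curve_on A h, A t & \forall t' \near t, h t' = g t'].
  rewrite in_itv /= -{1}s0 -{1}sk => /andP[at_ tb] tP.
  have [j jk /andP[jt tj]] := subdivision_locate at_ tb tP.
  have [_ [A [h [oA sh gh]]]] := ps j jk; exists A, h; split=> //.
    by have [] := gh t; rewrite ?(ltW jt) ?(ltW tj).
  have /near_in_itvoo : t \in `]s j, s j.+1[ by rewrite in_itv /= jt tj.
  apply: filterS => t'; rewrite in_itv /= => /andP[h1 h2].
  by have [] := gh t'; rewrite ?(ltW h1) ?(ltW h2).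
have reg t : t \in `]a, b[ -> t \notin P -> regular_at g t.
  move=> tab tP; have [A [h [oA sh At hg]]] := loc t tab tP.
  exact: near_regular hg (smooth_curve_regular sh At).
have csp t : t \in `]a, b[ -> t \notin P -> {for t, continuous (speed F g)}.
  move=> tab tP; have [A [h [oA sh At hg]]] := loc t tab tP.
  have := smooth_curve_speed_continuous (F := F) oA sh At.
  rewrite /prop_for /continuous_at (near_speed F hg) => ch.
  apply: cvg_trans ch; apply: near_eq_cvg.
  apply: filterS (nbhs_interior hg) => t' hg'; exact: near_speed hg'.
have isp : (@lebesgue_measure R).-integrable `[a, b] (EFin \o speed F g).
  rewrite -s0 -sk; apply: integrable_piecewise => j jk.
  have [slt [A [h [oA sh gh]]]] := ps j jk; split=> //; exists (speed F h).
    apply: continuous_in_subspaceT => t; rewrite inE /= in_itv /= => /gh[At _].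
    exact: (smooth_curve_speed_continuous oA sh At).
  move=> t tj; apply: near_speed; have /near_in_itvoo := tj; apply: filterS => t'.
  by rewrite in_itv /= => /andP[h1 h2]; have [] := gh t'; rewrite ?(ltW h1) ?(ltW h2).
have [u pu uE] := Rintegral_primitive_off ab isp csp.
by exists P, u; split=> //; exact: ltW.
Qed.

End Curves.

(** * Calibrations and exit times *)

(** Real induction. At the infimum of the failures [Q] holds by the first two hypotheses, and the
    third one then keeps failures at a positive distance from it, a contradiction. *)
Lemma itv_induction {R : realType} (a b : R) (Q : R -> Prop) :
  Q a ->
  (forall t, a < t -> t <= b -> (forall s, a <= s -> s < t -> Q s) -> Q t) ->
  (forall t, a <= t -> t <= b -> Q t ->
    exists2 e, 0 < e & forall s, t < s -> s < t + e -> s <= b -> Q s) ->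
  forall t, a <= t -> t <= b -> Q t.
Proof.
move=> Qa Qlim Qopen t at_ tb; apply: contrapT => nQt.
pose T := [set s | a <= s /\ s <= b /\ ~ Q s].
have Tt : T t by split.
have Tinf : has_inf T by split; [exists t|exists a => s []].
have below s : a <= s -> s < inf T -> Q s.
  move=> as_ sT; apply: contrapT => nQs; have := sT; apply/negP; rewrite -leNgt.
  apply: inf_lbound; first exact: Tinf.2.
  by split=> //; split=> //; rewrite (le_trans _ tb)// (le_trans (ltW sT))//; apply: inf_lbound; first exact: Tinf.2.
have aT : a <= inf T by apply: lb_le_inf; [exact: Tinf.1|move=> s []].
have Tb : inf T <= b by rewrite (le_trans _ tb)//; apply: inf_lbound; first exact: Tinf.2.
have QT : Q (inf T).
  by move: aT; rewrite le_eqVlt => /predU1P[<-//|aT]; exact: Qlim.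
have [e e0 Qe] := Qopen _ aT Tb QT.
have [s [as_ [sb nQs]] sT] := inf_adherent e0 Tinf.
apply: nQs; have [sT'|Ts|->//] := ltgtP s (inf T); first exact: below.
exact: Qe.
Qed.

Lemma row_norm_lt {R : realType} (n : nat) (v : 'rV[R]_n) (r : R) : 0 < r ->
  (forall k, `|v 0 k| < r) -> `|v| < r.
Proof.
move=> r0 vr; rewrite /Num.Def.normr /= mx_normrE; apply/bigmax_ltP; split=> //.
by move=> -[i j] _ /=; rewrite (ord1 i).
Qed.

Lemma row_norm_ge {R : realType} (n : nat) (v : 'rV[R]_n) k : `|v 0 k| <= `|v|.
Proof.
rewrite [leRHS]/Num.Def.normr /= mx_normrE.
exact: (le_bigmax _ (fun i : 'I_1 * 'I_n => `|v i.1 i.2|) (0, k)).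
Qed.

Lemma within_continuous_postcomp {R : realType} (T U : topologicalType) (A : set R)
    (g : R -> T) (h : T -> U) : {within A, continuous g} ->
  (forall t, A t -> {for g t, continuous h}) -> {within A, continuous (h \o g)}.
Proof.
move=> cg ch; apply/subspace_continuousP => t At.
exact: (cvg_comp _ _ ((subspace_continuousP _ g).1 cg t At) (ch t At)).
Qed.

Lemma within_continuous_near {R : realType} (T : topologicalType) (a b : R)
    (g : R -> T) t (N : set T) : {within `[a, b], continuous g} ->
  a <= t -> t <= b -> nbhs (g t) N ->
  exists2 e, 0 < e & forall s, a <= s -> s <= b -> `|t - s| < e -> N (g s).
Proof.
move=> cg at_ tb Ngt; have tab : `[a, b]%classic t by rewrite /= in_itv /= at_.
have [e /= e0 eN] := (subspace_continuousP _ g).1 cg t tab N Ngt.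
by exists e => // s as_ sb ts; apply: (eN s) => //=; rewrite in_itv /= as_.
Qed.

Section Calibration.
Variables (R : realType) (n : nat) (M : manifold R n).
Local Notation dom i := (cdom (@atlas R n M i)).
Local Notation phi i := (ccoord (@atlas R n M i)).
Local Notation psi i := (cinv (@atlas R n M i)).
Implicit Types (F : finsler_metric M) (i : Defs.index M) (g : R -> M).

Lemma length_primitive_ge0 F a b g P u : length_primitive F a b g P u ->
  0 <= curve_length F a b g.
Proof.
move=> [ab _ _ pu ->]; rewrite subr_ge0.
by apply: (primitive_off_ndecr ab pu) => t _ _; exact: speed_ge0.
Qed.

(** Along the arc up to [t0] the function c l(phi(g(t))) has derivative at most the speed; the rest
    of the curve, which may leave the chart, only adds length. *)
Lemma chart_calibration F i (l : {linear 'rV[R]_n -> R}) (c : R) a b g P u t0 :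
  continuous l -> length_primitive F a b g P u -> a <= t0 -> t0 <= b ->
  (forall t, a <= t -> t <= t0 -> dom i (g t) /\
     forall v, c * l v <= local_expr F i (phi i (g t), v)) ->
  c * (l (phi i (g t0)) - l (phi i (g a))) <= curve_length F a b g.
Proof.
move=> cl [ab cg rg pu ->] at0 t0b lF.
have pu0 : primitive_off P a t0 (speed F g) u by exact: primitive_off_sub pu.
apply: (@le_trans _ _ (u t0 - u a)); last first.
  rewrite lerD2r; apply: (@primitive_off_ndecr R P t0 b (speed F g)) => //.
    exact: primitive_off_sub pu.
  by move=> t _ _; exact: speed_ge0.
pose w t := c * l (phi i (g t)).
have -> : c * (l (phi i (g t0)) - l (phi i (g a))) = w t0 - w a by rewrite mulrBr.
apply: (@primitive_off_le R P P a t0 (fun t => c * l (derive1 (phi i \o g) t)) (speed F g)) => //.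
  split.
    have cg0 : {within `[a, t0], continuous g}.
      by apply: continuous_subspaceW cg; apply: subset_itv; rewrite bnd_simp.
    apply: (within_continuous_postcomp (h := fun p => c * l (phi i p)) cg0) => t.
    rewrite /= in_itv /= => /andP[at_ tt0]; apply: cvgMl_tmp.
    apply: continuous_comp; last exact: cl.
    by apply: ccoord_continuous; have [] := lF t at_ tt0.
  move=> t; rewrite in_itv /= => /andP[at_ tt0] tP.
  have [it _] := lF t (ltW at_) (ltW tt0).
  have tab : t \in `]a, b[ by rewrite in_itv /= at_ (lt_le_trans tt0).
  have dg : differentiable (phi i \o g) t by exact: (rg t tab tP).2.
  have dlg : differentiable (l \o (phi i \o g)) t.
    by apply: differentiable_comp => //; exact: linear_differentiable.
  rewrite -[w]/(c *: (l \o (phi i \o g))); split.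
    by apply: derivableZ; exact: diff_derivable.
  rewrite deriveZ; last exact: diff_derivable.
  rewrite deriveE// diff_comp//; last exact: linear_differentiable.
  by rewrite /= diff_lin// derive1E'.
move=> t; rewrite in_itv /= => /andP[at_ tt0]; rewrite mem_cat orbb => tP.
have [it lFt] := lF t (ltW at_) (ltW tt0).
have tab : t \in `]a, b[ by rewrite in_itv /= at_ (lt_le_trans tt0).
by rewrite (speed_chart F (rg t tab tP) it).
Qed.

(** Taken with [s] equal to 1 and -1, these forms bound a coordinate increment from both sides. *)
Lemma coordinate_form (k : 'I_n) (s : R) : exists l : {linear 'rV[R]_n -> R},
  continuous l /\ forall v, l v = s * v 0 k.
Proof.
pose f (v : 'rV[R]_n) := s * v 0 k.
have lf : linear f by move=> a u v; rewrite /f !mxE mulrDr mulrCA.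
pose lfm := GRing.isLinear.Build R 'rV[R]_n R _ f lf.
exists (HB.pack f lfm : {linear 'rV[R]_n -> R}); split=> // v.
have cv := @coord_continuous R 1 n 0 k v.
suff : {for v, continuous f} by [].
exact: (@cvgMl_tmp _ _ _ _ (fun w : 'rV[R]_n => w 0 k) s _ cv).
Qed.

(* A short curve starting near [x0] cannot leave the chart ball: at the first
   exit time it lies in the image of the closed ball, which is compact and hence
   closed in the Hausdorff space [M], and the coordinate functions calibrate the
   initial arc. *)
Lemma short_curve_in_chart F i x0 (r0 : R) : cimg (atlas i) x0 -> 0 < r0 ->
  exists r eta : R, [/\ 0 < r, r <= r0, 0 < eta &
    forall a b g P u x, length_primitive F a b g P u -> `|x0 - x| < r ->
      g a = psi i x -> curve_length F a b g < eta ->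
      forall t, a <= t -> t <= b -> dom i (g t) /\ `|x0 - phi i (g t)| < r0].
Proof.
move=> ix0 r00; have [c [C [c0 C0 bnd]]] := local_expr_bounds F ix0.
have /nbhs_closedballP[d dB] :
    \forall x \near x0, cimg (atlas i) x /\
      forall y, c * `|y| <= local_expr F i (x, y) <= C * `|y|.
  by apply: filterI => //; exact: near_cimg.
pose rho := Num.min d%:num r0; have rho0 : 0 < rho by rewrite lt_min r00 andbT.
have rB x : `|x0 - x| <= rho -> cimg (atlas i) x /\
    forall y, c * `|y| <= local_expr F i (x, y) <= C * `|y|.
  move=> xr; apply: dB; rewrite closed_ballE// /closed_ball_ /= (le_trans xr)//.
  by rewrite ge_min lexx.
pose Kb := [set x : 'rV[R]_n | `|x0 - x| <= rho].
have cKb : compact Kb.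
  apply: bounded_closed_compact.
    exists (`|x0| + rho); split; first exact: num_real.
    move=> z /ltW hz x xK; apply: le_trans hz.
    rewrite -[x](subKr x0) (le_trans (ler_normB _ _))// lerD2l; exact: xK.
  have -> : Kb = closed_ball x0 rho by rewrite closed_ballE.
  exact: closed_ball_closed.
pose K := psi i @` Kb.
have clK : closed K.
  apply: compact_closed; first exact: points_hausdorff.
  apply: continuous_compact cKb; apply: continuous_in_subspaceT => x.
  by rewrite inE => xK; apply: cinv_continuous; exact: (rB x xK).1.
(* The curve starts within rho / 2 of [x0], and since F >= c |v| on the closed ball, a length below
   c rho / 2 moves it by less than another rho / 2. *)
exists (rho / 2), (c * (rho / 2)); split.
- by rewrite divr_gt0.
- by rewrite (@le_trans _ _ rho) ?ge_min ?lexx ?orbT//; lra.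
- by rewrite mulr_gt0// divr_gt0.
move=> a b g P u x lp x0x ga short.
pose B q := dom i q /\ `|x0 - phi i q| < rho.
suff H : forall t, a <= t -> t <= b -> B (g t).
  move=> t at_ tb; have [it xt] := H t at_ tb; split=> //.
  by rewrite (lt_le_trans xt)// ge_min lexx orbT.
have xrho : `|x0 - x| < rho by apply: (lt_le_trans x0x); lra.
have ix : cimg (atlas i) x by exact: (rB x (ltW xrho)).1.
have within_open t (N : set M) := @within_continuous_near _ _ a b g t N (lp_continuous lp).
apply: itv_induction.
- by rewrite /B ga ccoord_cinv//; split=> //; exact: cdom_cinv.
- move=> t at_ tb Bs.
  have gtK : K (g t).
    apply: contrapT => nK.
    have [|e e0 eN] := within_open t (~` K) (ltW at_) tb.
      by apply: open_nbhs_nbhs; split=> //; exact: closed_openC.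
    pose s := Num.max a (t - e / 2).
    have as_ : a <= s by rewrite le_max lexx.
    have st : s < t by rewrite gt_max at_ /=; lra.
    have ts : t - e / 2 <= s by rewrite le_max lexx orbT.
    have [is_ xs] := Bs s as_ st.
    apply: (eN s) => //; first by rewrite (le_trans (ltW st)).
      by rewrite gtr0_norm ?subr_gt0//; lra.
    by exists (phi i (g s)); [exact: ltW|rewrite ccoordK].
  have Ks s : a <= s -> s <= t -> dom i (g s) /\ `|x0 - phi i (g s)| <= rho.
    move=> as_; rewrite le_eqVlt => /predU1P[->|st]; last first.
      by have [? /ltW] := Bs s as_ st.
    have [z zK <-] := gtK; have iz := (rB z zK).1.
    by rewrite ccoord_cinv//; split=> //; exact: cdom_cinv.
  split; first by have [] := Ks t (ltW at_) (lexx _).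
  suff : `|phi i (g t) - phi i (g a)| < rho / 2.
    rewrite ga ccoord_cinv// distrC => h.
    have -> : x0 - phi i (g t) = (x0 - x) + (x - phi i (g t)) by rewrite subrKA.
    rewrite (le_lt_trans (ler_normD _ _))//; lra.
  apply: row_norm_lt => [|k]; first by rewrite divr_gt0.
  (* The norm is the maximum of the coordinates, so the displacement is bounded one signed
     coordinate at a time, each by its own linear calibration. *)
  have calib e : `|e| = 1 -> c * (e * (phi i (g t) 0 k - phi i (g a) 0 k)) < c * (rho / 2).
    move=> e1; apply: le_lt_trans short; have [l [cl lE]] := coordinate_form k e.
    rewrite mulrBr -!lE; apply: (chart_calibration cl lp (ltW at_) tb) => s as_ st.
    have [is_ xs] := Ks s as_ st; split=> // v.
    have /andP[+ _] := (rB _ xs).2 v; apply: le_trans; rewrite ler_pM2l// lE.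
    by rewrite (le_trans (ler_norm _))// normrM e1 mul1r row_norm_ge.
  rewrite ltr_norml !mxE; apply/andP; split.
    have := calib (-1); rewrite normrN1 => /(_ erefl); rewrite ltr_pM2l//; lra.
  have := calib 1; rewrite normr1 => /(_ erefl); rewrite ltr_pM2l//; lra.
- move=> t at_ tb [it xt].
  have [|e e0 eN] := within_open t B at_ tb.
    apply: filterI; first exact: cdom_nbhs.
    have cphi := @ccoord_continuous _ _ _ (atlas i) _ it.
    apply: (cphi [set z | `|x0 - z| < rho]).
    have : nbhs (phi i (g t)) (ball x0 rho).
      by apply: open_nbhs_nbhs; split; [exact: ball_open|rewrite -ball_normE].
    by rewrite -ball_normE.
  exists e => // s ts se sb; apply: eN => //; first by rewrite (le_trans at_)// ltW.
  by rewrite ltr0_norm ?subr_lt0//; lra.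
Qed.

End Calibration.

(** * Operations on curves *)

Section CurveOperations.
Variables (R : realType) (n : nat) (M : manifold R n).
Local Notation dom i := (cdom (@atlas R n M i)).
Local Notation phi i := (ccoord (@atlas R n M i)).
Local Notation psi i := (cinv (@atlas R n M i)).
Local Notation tau i j := (transition (@atlas R n M i) (@atlas R n M j)).
Implicit Types (F : finsler_metric M) (i : Defs.index M) (g h : R -> M).

Section Reparametrization.
Variables (e c : R).
(** Only translations ([e] equal to 1) and the reversal ([e] equal to -1, [c] equal to 0) are used
    later; the unsimplified [1 * t + c] and [-1 * t + 0] keep them literal instances of this map. *)
Let sigma (t : R) := e * t + c.

Lemma affine_continuous t : {for t, continuous sigma}.
Proof. by apply: cvgD; [apply: cvgMl_tmp; exact: cvg_id|exact: cvg_cst]. Qed.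

Lemma affine_line (t v s : R) : sigma (s *: v + t) = s *: (e * v) + sigma t.
Proof. by rewrite /sigma mulrDr -addrA; congr (_ + _); rewrite mulrCA. Qed.

Lemma affine_differentiable t : differentiable sigma t.
Proof.
have -> : sigma = e *: id + cst c by [].
by apply: differentiableD => //; exact: differentiableZ.
Qed.

Lemma smooth_curve_affine (A : set R) h : smooth_curve_on A h ->
  smooth_curve_on (sigma @^-1` A) (h \o sigma).
Proof.
move=> [ch sh]; split=> [t At|i].
  by apply: continuous_comp; [exact: affine_continuous|exact: ch].
exact: (smooth_on_affine (T := fun v => e * v) (fun t v s => affine_line t v s)
  affine_differentiable (sh i)).
Qed.

Lemma derive1_affine (V : normedModType R) (f : R -> V) t :
  differentiable f (sigma t) ->
  derive1 (f \o sigma) t = e *: derive1 f (sigma t).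
Proof.
move=> df; rewrite !derive1E.
rewrite (@derive_affine _ _ _ _ f sigma (fun v => e * v) t 1); last first.
  by move=> s; exact: affine_line.
by rewrite -deriveZr.
Qed.

Lemma regular_affine g t : regular_at g (sigma t) -> regular_at (g \o sigma) t.
Proof.
move=> [cg dg]; split=> [|i it].
  by apply: continuous_comp; [exact: affine_continuous|].
by apply: (@differentiable_comp _ _ _ _ sigma (phi i \o g)); [exact: affine_differentiable|exact: dg].
Qed.

Lemma speed_affine F i g t : regular_at g (sigma t) -> dom i (g (sigma t)) ->
  speed F (g \o sigma) t =
  local_expr F i (phi i (g (sigma t)), e *: derive1 (phi i \o g) (sigma t)).
Proof.
move=> rg it; rewrite (speed_chart F (regular_affine rg) it).
by rewrite -(derive1_affine (rg.2 i it)).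
Qed.

Lemma within_continuous_affine (T : topologicalType) (A : set R) (u : R -> T) :
  {within A, continuous u} -> {within sigma @^-1` A, continuous (u \o sigma)}.
Proof.
move=> cu; apply/subspace_continuousP => t At W Wt.
have cut := (subspace_continuousP _ u).1 cu (sigma t) At W Wt.
exact: (affine_continuous cut).
Qed.

End Reparametrization.

Lemma is_derive_affine (e c : R) (u : R -> R) t du :
  is_derive (e * t + c) 1 u du ->
  is_derive t 1 (fun s => u (e * s + c)) (e * du).
Proof.
move=> [dv de]; have df : differentiable u (e * t + c) by exact/derivable1_diffP.
split.
  apply/derivable1_diffP.
  exact: (differentiable_comp (affine_differentiable e c t)).
by rewrite -derive1E (derive1_affine (e := e) df) derive1E de.
Qed.

Lemma piecewise_smooth_shift (a b c : R) g : piecewise_smooth a b g ->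
  piecewise_smooth (a - c) (b - c) (fun t => g (1 * t + c)).
Proof.
move=> [k [s [s0 sk ps]]]; exists k, (fun j => s j - c); split; rewrite ?s0 ?sk// => j jk.
have [slt [A [h [oA sh gh]]]] := ps j jk; split; first by rewrite ltrD2r.
exists ((fun t => 1 * t + c) @^-1` A), (h \o (fun t => 1 * t + c)); split.
- by apply: open_comp => // t _; exact: affine_continuous.
- exact: smooth_curve_affine.
- by move=> t ht; apply: gh; lra.
Qed.

Lemma piecewise_smooth_rev (a b : R) g : piecewise_smooth a b g ->
  piecewise_smooth (- b) (- a) (fun t => g (-1 * t + 0)).
Proof.
move=> [k [s [s0 sk ps]]]; exists k, (fun j => - s (k - j)%N); split.
- by rewrite subn0 sk.
- by rewrite subnn s0.
move=> j jk; have jk' : (k - j.+1 < k)%N by rewrite ltn_subrL /= (leq_ltn_trans _ jk).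
have [slt [A [h [oA sh gh]]]] := ps _ jk'.
have kj : ((k - j.+1).+1 = k - j)%N by exact: subnSK.
rewrite kj in slt gh; split; first by rewrite ltrN2.
exists ((fun t => -1 * t + 0) @^-1` A), (h \o (fun t => -1 * t + 0)); split.
- by apply: open_comp => // t _; exact: affine_continuous.
- exact: smooth_curve_affine.
- by move=> t ht; apply: gh; lra.
Qed.

Definition concat (b : R) g h : R -> M := fun t => if t <= b then g t else h t.

Lemma subdivision_le (s : nat -> R) (k m j : nat) : (forall l, (l < k)%N -> s l < s l.+1) ->
  (m <= j)%N -> (j <= k)%N -> s m <= s j.
Proof.
move=> sk; elim: j => [|j IH]; first by rewrite leqn0 => /eqP ->.
rewrite leq_eqVlt ltnS => /predU1P[->//|mj] jk.
by rewrite (le_trans (IH mj (ltnW jk)))// ltW// sk.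
Qed.

Lemma piecewise_smooth_concat (a b c : R) g h : piecewise_smooth a b g ->
  piecewise_smooth b c h -> g b = h b -> piecewise_smooth a c (concat b g h).
Proof.
move=> [k [s [s0 sk ps]]] [k' [s' [s'0 sk' ps']]] gh.
exists (k + k')%N, (fun j => if (j <= k)%N then s j else s' (j - k)%N); split.
- by rewrite leq0n.
- case: leqP => [|_]; last by rewrite addKn.
  rewrite -{2}[k]addn0 leq_add2l leqn0 => /eqP k'0.
  by rewrite k'0 addn0 sk -s'0 -sk' k'0.
move=> j jk; have [jlt|kj] := ltnP j k.
  have [slt [A [h1 [oA sh gh1]]]] := ps j jlt.
  rewrite (ltnW jlt); split=> //; exists A, h1; split=> // t tj.
  have [At <-] := gh1 t tj; split=> //; rewrite /concat ifT//.
  move/andP: tj => [_ /le_trans]; apply; rewrite -sk.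
  by apply: (@subdivision_le s k) => // l lk; have [] := ps l lk.
(* At [j = k] the two subdivisions meet, since [s k] and [s' 0] are both [b]. *)
have -> : (if (j <= k)%N then s j else s' (j - k)%N) = s' (j - k)%N.
  case: ifP => // jk2; have -> : j = k by apply/eqP; rewrite eqn_leq jk2 kj.
  by rewrite subnn sk s'0.
have jk' : (j - k < k')%N by rewrite ltn_subLR.
have [slt [A [h1 [oA sh gh1]]]] := ps' _ jk'.
rewrite subSn//; split=> //; exists A, h1; split=> // t tj.
have [At ht] := gh1 t tj; split=> //; rewrite -ht /concat; case: ifP => // tb.
have -> : t = b; last exact: gh.
apply/le_anti; rewrite tb /=; move/andP: tj => [+ _]; apply: le_trans.
rewrite -s'0; apply: (@subdivision_le s' k') => //; last exact: ltnW.
by move=> l lk; have [] := ps' l lk.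
Qed.

End CurveOperations.

(** * Distance *)

Section Distance.
Variables (R : realType) (n : nat) (M : manifold R n).
Local Notation dom i := (cdom (@atlas R n M i)).
Local Notation phi i := (ccoord (@atlas R n M i)).
Local Notation psi i := (cinv (@atlas R n M i)).
Local Notation tau i j := (transition (@atlas R n M i) (@atlas R n M j)).
Implicit Types (F : finsler_metric M) (i : Defs.index M) (g h : R -> M).

Definition lengths F (x y : M) : set R :=
  [set l : R | exists (a b : R) (g : R -> M),
    [/\ a < b, piecewise_smooth a b g, g a = x, g b = y &
        l = curve_length F a b g]].

Lemma lengths_ge0 F x y l : lengths F x y l -> 0 <= l.
Proof.
move=> [a [b [g [ab pg _ _ ->]]]].
by have [P [u lp]] := length_primitiveP F ab pg; exact: length_primitive_ge0 lp.
Qed.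

Lemma finsler_dist_le F x y l : lengths F x y l -> finsler_dist F x y <= l.
Proof. by apply: inf_lbound; exists 0 => m; exact: lengths_ge0. Qed.

Lemma finsler_dist_ge F x y m : lengths F x y !=set0 ->
  (forall l, lengths F x y l -> m <= l) -> m <= finsler_dist F x y.
Proof. by move=> n0 lb; exact: lb_le_inf. Qed.

Lemma finsler_dist_ge0 F x y : 0 <= finsler_dist F x y.
Proof.
have [n0|/set0P/negP/negPn/eqP e0] := pselect (lengths F x y !=set0).
  by apply: finsler_dist_ge => // l; exact: lengths_ge0.
by rewrite /finsler_dist -[X in inf X]/(lengths F x y) e0 inf0.
Qed.

(** The second curve is translated to start where the first one ends. On each side of the junction
    the primitive of the whole curve is compared with that of the piece, so the speed at the
    junction itself never matters. *)
Lemma lengths_concat F x y z l m : lengths F x y l -> lengths F y z m ->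
  lengths F x z (l + m).
Proof.
move=> [a [b [g [ab pg ga gb lE]]]] [c [d [h [cd ph hc hd mE]]]].
pose k := c - b; pose d' := d - k.
pose sigma t := 1 * t + k; pose h' := h \o sigma.
have ph' : piecewise_smooth b d' h'.
  by have := piecewise_smooth_shift k ph; rewrite {1}/k subKr.
have bd' : b < d' by rewrite /d' /k; move: cd; clear; lra.
have sb : sigma b = c by rewrite /sigma /k; clear; ring.
have sd' : sigma d' = d by rewrite /sigma /d'; clear; ring.
have gh : g b = h' b by rewrite /h' /= sb gb hc.
have pG := piecewise_smooth_concat pg ph' gh; set G := concat b g h' in pG.
have ad' : a < d' by exact: lt_trans bd'.
exists a, d', G; split; [exact: ad'|exact: pG| | |].
- by rewrite /G /concat (ltW ab).
- by rewrite /G /concat leNgt bd' /= /h' /= sd'.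
have [PG [uG lpG]] := length_primitiveP F ad' pG.
have [P1 [u1 lp1]] := length_primitiveP F ab pg.
have [P2 [u2 lp2]] := length_primitiveP F cd ph.
rewrite lE mE (lp_length lpG) (lp_length lp1) (lp_length lp2).
have -> : u1 b - u1 a = uG b - uG a.
  apply: (primitive_off_eq (ltW ab) (lp_primitive lp1)
    (primitive_off_sub (lexx a) (ltW bd') (lp_primitive lpG))).
  move=> t; rewrite in_itv /= => /andP[_ tb] _; apply: near_speed.
  near=> s; rewrite /G /concat ifT//; apply: ltW; near: s; exact: lt_nbhsl.
have -> : u2 d - u2 c = uG d' - uG b; last by rewrite addrC subrKA.
rewrite -sb -sd'; pose P2' := [seq t - k | t <- P2].
have sP t : t \notin P2' -> sigma t \notin P2.
  by apply: contra => tP; apply/mapP; exists (sigma t) => //; rewrite /sigma; clear; ring.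
have sI t : t \in `]b, d'[ -> sigma t \in `]c, d[.
  by rewrite !in_itv /= /sigma /d' /k; clear => /andP[h1 h2]; apply/andP; split; lra.
have p2 : primitive_off P2' b d' (fun t => speed F h (sigma t)) (u2 \o sigma).
  have [cu2 du2] := lp_primitive lp2; split.
    have -> : `[b, d']%classic = sigma @^-1` `[c, d]%classic.
      apply/seteqP; split=> t /=; rewrite !in_itv /= /sigma /d' /k; clear => /andP[h1 h2];
      by apply/andP; split; lra.
    exact: within_continuous_affine.
  move=> t tI tP; have := is_derive_affine (du2 _ (sI t tI) (sP t tP)).
  by rewrite mul1r.
apply: (primitive_off_eq (ltW bd') p2
  (primitive_off_sub (ltW ab) (lexx d') (lp_primitive lpG))).
move=> t tI; rewrite mem_cat negb_or => /andP[tP _].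
have rt := lp_regular lp2 (sI t tI) (sP t tP).
have it := projT2 (cid (atlas_cover (h (sigma t)))).
have -> : speed F G t = speed F h' t.
  move: tI; rewrite in_itv /= => /andP[bt _]; apply: near_speed.
  near=> s; rewrite /G /concat ifF//; apply/negbTE; rewrite -ltNge.
  by near: s; exact: lt_nbhsr.
by rewrite (speed_affine F rt it) scale1r (speed_chart F rt it).
Unshelve. all: by end_near. Qed.

Lemma finsler_dist_triangle F x y z : lengths F x z !=set0 -> lengths F z y !=set0 ->
  finsler_dist F x y <= finsler_dist F x z + finsler_dist F z y.
Proof.
move=> xz zy; rewrite -lerBlDr; apply: finsler_dist_ge => // l xzl.
rewrite lerBlDr addrC -lerBlDr; apply: finsler_dist_ge => // m zym.
by rewrite lerBlDr addrC; apply: finsler_dist_le; exact: lengths_concat zym.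
Qed.

Lemma affine_line_continuous (x y : 'rV[R]_n) t :
  {for t, continuous (fun s : R => s *: y + x)}.
Proof. by apply: cvgD; [apply: cvgZr_tmp; exact: cvg_id|exact: cvg_cst]. Qed.

Lemma affine_line_differentiable (x y : 'rV[R]_n) t :
  differentiable (fun s : R => s *: y + x) t.
Proof.
have -> : (fun s : R => s *: y + x) = ( *:%R^~ y) + cst x by [].
by apply: differentiableD => //; exact: differentiableZl.
Qed.

Lemma derive1_line (x y : 'rV[R]_n) t : derive1 (fun s : R => s *: y + x) t = y.
Proof.
by rewrite derive1E (@derive_line _ _ _ id x y t) derive_id.
Qed.

Lemma smooth_chart_line i (x y : 'rV[R]_n) :
  smooth_curve_on [set t : R | cimg (atlas i) (t *: y + x)]
    (fun t => psi i (t *: y + x)).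
Proof.
pose line (t : R) := t *: y + x.
split=> [t it|j].
  apply: (@continuous_comp _ _ _ line (psi i)).
    exact: affine_line_continuous.
  exact: cinv_continuous.
have aff (t v s : R) : line (s *: v + t) = s *: (v *: y) + line t.
  by rewrite /line scalerDl -scalerA addrA.
have := smooth_on_affine aff (affine_line_differentiable x y)
  (@atlas_compat R n M i j).
apply: smooth_on_subset => t [it jt].
exists (psi i (line t)); first by split=> //; exact: cdom_cinv.
exact: ccoord_cinv.
Qed.

(** Balls are convex, so the segment parametrized on [0, 1] stays where the bound by [K] holds, and
    its coordinate velocity is the constant [x2 - x1]. *)
Lemma chart_segment_length F i x0 (K r : R) :
  (forall x, `|x0 - x| < r -> cimg (atlas i) x /\
     forall y, local_expr F i (x, y) <= K * local_expr F i (x0, y)) ->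
  forall x1 x2, `|x0 - x1| < r -> `|x0 - x2| < r ->
  exists2 l, lengths F (psi i x1) (psi i x2) l & l <= K * local_expr F i (x0, x2 - x1).
Proof.
move=> Br x1 x2 x1r x2r; set y := x2 - x1.
pose line (t : R) := t *: y + x1; pose g t := psi i (line t).
have lineB t : 0 <= t -> t <= 1 -> `|x0 - line t| < r.
  move=> t0 t1; have -> : x0 - line t = (1 - t) *: (x0 - x1) + t *: (x0 - x2).
    by apply/rowP => k; rewrite /line /y !mxE; ring.
  rewrite (le_lt_trans (ler_normD _ _))// !normrZ (ger0_norm t0) ger0_norm ?subr_ge0//.
  (* At t = 1 the first term vanishes, and strictness has to come from the second one. *)
  have [->|tn1] := eqVneq t 1; first by rewrite subrr mul0r add0r mul1r.
  have -> : r = (1 - t) * r + t * r by ring.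
  apply: ltr_leD; last by rewrite ler_wpM2l// ltW.
  by rewrite ltr_pM2l// subr_gt0 lt_neqAle tn1.
pose A := [set t : R | cimg (atlas i) (line t)].
have sg : smooth_curve_on A g by exact: smooth_chart_line.
have iB t : 0 <= t -> t <= 1 -> cimg (atlas i) (line t).
  by move=> t0 t1; exact: (Br _ (lineB t t0 t1)).1.
have pg : piecewise_smooth 0 1 g.
  exists 1%N, (fun j : nat => j%:R); split=> // -[|//] _; split; first exact: ltr01.
  exists A, g; split=> //.
    have -> : A = line @^-1` cimg (atlas i) by [].
    by apply: open_comp; [move=> t _; exact: affine_line_continuous|exact: cimg_open].
  by move=> t /andP[t0 t1]; split=> //; exact: iB.
exists (curve_length F 0 1 g).
  exists 0, 1, g; split; [exact: ltr01|exact: pg| | |by []].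
    by rewrite /g /line scale0r add0r.
  by rewrite /g /line scale1r /y subrK.
have [P [u lp]] := length_primitiveP F ltr01 pg.
set m := K * _; have -> : m = m * 1 - m * 0 by ring.
rewrite (lp_length lp).
apply: (primitive_off_le (P2 := [::]) (k2 := cst m) (u2 := fun t => m * t) ler01 (lp_primitive lp)).
  split; first by apply: continuous_subspaceT => t; apply: cvgMl_tmp; exact: cvg_id.
  move=> t _ _; have : is_derive t 1 (m *: id) (m *: (1 : R)) by exact: is_deriveZ.
  by rewrite -[m *: 1]/(m * 1) mulr1.
move=> t; rewrite in_itv /= => /andP[t0 t1] _.
have At : A t by apply: iB; exact: ltW.
have it : dom i (g t) by exact: cdom_cinv.
have phig : derive1 (phi i \o g) t = y.
  rewrite -(derive1_line x1 y t) !derive1E; apply: near_eq_derive.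
  have nC : nbhs (line t) (cimg (atlas i)) by exact: near_cimg.
  have : \forall s \near t, cimg (atlas i) (line s).
    exact: (@affine_line_continuous x1 y t _ nC).
  by apply: filterS => s; exact: ccoord_cinv.
rewrite (speed_chart F (smooth_curve_regular sg At) it) phig ccoord_cinv//.
exact: (Br _ (lineB t (ltW t0) (ltW t1))).2.
Qed.

End Distance.

(** * Comparison of the distance with a norm near a point *)

Section LocalDistance.
Variables (R : realType) (n : nat) (M : manifold R n).
Local Notation dom i := (cdom (@atlas R n M i)).
Local Notation phi i := (ccoord (@atlas R n M i)).
Local Notation psi i := (cinv (@atlas R n M i)).
Implicit Types (F : finsler_metric M) (i : Defs.index M).

(* A Finsler length is bounded below near [x0] by the calibrating form
   [l = d(F x0)] at [x2 - x1], which satisfies [l <= F x0] by convexity. *)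
Lemma length_local_ge F i x0 (e : R) : cimg (atlas i) x0 -> 0 < e -> e < 1 ->
  exists2 r, 0 < r & forall x1 x2, `|x0 - x1| < r -> `|x0 - x2| < r ->
    forall l, lengths F (psi i x1) (psi i x2) l ->
    (1 - e) * local_expr F i (x0, x2 - x1) <= l.
Proof.
move=> ix0 e0 e1; have [c [C [c0 C0 bnd]]] := local_expr_bounds F ix0.
have /nbhs_normP[r0 /= r00 Br0] : \forall x \near x0, cimg (atlas i) x /\
    forall y, (1 - e) * local_expr F i (x0, y) <= local_expr F i (x, y) <=
      (1 + e) * local_expr F i (x0, y).
  by apply: filterI; [exact: near_cimg|exact: local_expr_near].
have [r [eta [r_gt0 rr0 eta0 short]]] := short_curve_in_chart F ix0 r00.
(* For points this close |x2 - x1| <= eta / C, hence F(x0, x2 - x1) <= eta: curves of length at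
   least [eta] satisfy the bound at once, and the others stay in the chart. *)
exists (Num.min r (eta / (2 * C))).
  by rewrite lt_min r_gt0 divr_gt0// mulr_gt0.
move=> x1 x2; rewrite !lt_min => /andP[x1r x1e] /andP[x2r x2e] l.
move=> [a [b [g [ab pg ga gb lE]]]].
have inB x : `|x0 - x| < r -> cimg (atlas i) x.
  by move=> xr; apply: (Br0 x _).1; rewrite /ball_ /= (lt_le_trans xr).
set y := x2 - x1; have [P [u lp]] := length_primitiveP F ab pg.
(* The calibrating form is the differential of the norm at [y], available for nonzero [y] only. *)
have [y0|yn0] := eqVneq y 0.
  by rewrite y0 local_expr0 mulr0 lE; exact: length_primitive_ge0 lp.
have [etal|leta] := leP eta l.
  apply: le_trans etal; apply: (@le_trans _ _ (local_expr F i (x0, y))).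
    by rewrite ler_piMl ?local_expr_ge0//; move: e0; clear; lra.
  have /andP[_ /le_trans] := nbhs_singleton bnd y; apply.
  have : `|y| <= eta / (2 * C) + eta / (2 * C).
    have -> : y = (x0 - x1) - (x0 - x2) by apply/rowP => k; rewrite !mxE; ring.
    by rewrite (le_trans (ler_normB _ _))// lerD// ltW.
  move=> yC; rewrite -ler_pdivlMl//; apply: (le_trans yC).
  by rewrite le_eqVlt; apply/orP; left; apply/eqP; field; rewrite gt_eqF.
have ip0 : dom i (psi i x0) by exact: cdom_cinv.
have mF := minkowski_fibre F ip0.
pose f v := local_expr F i (x0, v).
have mf : minkowski_norm f by exact: mF.
have [_ fh f2 _] := mf.
have df : differentiable f y by exact: hom_differentiable f2 _ yn0.
rewrite lE.
have inr t : a <= t -> t <= b -> dom i (g t) /\ `|x0 - phi i (g t)| < r0.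
  move=> at_ tb; have := short _ _ _ _ _ _ lp x1r ga; rewrite -lE.
  by move=> /(_ leta t at_ tb).
rewrite -[local_expr F i (x0, y)]/(f y).
have -> : f y = 'd f y (phi i (g b)) - 'd f y (phi i (g a)).
  rewrite ga gb (ccoord_cinv (inB _ x1r)) (ccoord_cinv (inB _ x2r)).
  transitivity ('d f y y); last exact: raddfB.
  by rewrite -deriveE// (hom_euler fh yn0).
apply: (chart_calibration (diff_continuous df) lp (ltW ab) (lexx b)) => t at_ tb.
have [it xt] := inr t at_ tb; split=> // v.
rewrite -deriveE//; apply: (@le_trans _ _ ((1 - e) * f v)).
  by rewrite ler_pM2l ?subr_gt0//; exact: minkowski_support.
by have /andP[+ _] := (Br0 _ xt).2 v.
Qed.

Lemma finsler_dist_local F i x0 (e : R) : cimg (atlas i) x0 -> 0 < e -> e < 1 ->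
  exists2 r, 0 < r & forall x1 x2, `|x0 - x1| < r -> `|x0 - x2| < r ->
    [/\ cimg (atlas i) x1, lengths F (psi i x1) (psi i x2) !=set0 &
    (1 - e) * local_expr F i (x0, x2 - x1) <=
    finsler_dist F (psi i x1) (psi i x2) <=
    (1 + e) * local_expr F i (x0, x2 - x1)].
Proof.
move=> ix0 e0 e1; have [r1 r10 H1] := length_local_ge F ix0 e0 e1.
have /nbhs_normP[r2 /= r20 H2] : \forall x \near x0, cimg (atlas i) x /\
    forall y, local_expr F i (x, y) <= (1 + e) * local_expr F i (x0, y).
  apply: filterI; first exact: near_cimg.
  by apply: filterS (local_expr_near F ix0 e0) => x H y; have /andP[] := H y.
exists (Num.min r1 r2); first by rewrite lt_min r10 r20.
move=> x1 x2; rewrite !lt_min => /andP[x11 x12] /andP[x21 x22].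
have [l xl lle] := chart_segment_length H2 x12 x22.
have n0 : lengths F (psi i x1) (psi i x2) !=set0 by exists l.
split=> //; first exact: (H2 x1 x12).1.
apply/andP; split; first by apply: finsler_dist_ge => //; exact: H1.
by apply: le_trans lle; exact: finsler_dist_le.
Qed.

(** In a chart around [p] some ball misses [q], either because [q] is outside the chart or because
    its coordinates differ. Curves from [p] shorter than [eta] remain in that ball. *)
Lemma finsler_dist_gt0 F p q : lengths F p q !=set0 -> p <> q ->
  0 < finsler_dist F p q.
Proof.
move=> n0 pq; have ip := projT2 (cid (atlas_cover p)); set i := projT1 _ in ip.
have [r0 r00 Hq] : exists2 r : R, 0 < r & ~ (dom i q /\ `|phi i p - phi i q| < r).
  have [iq|niq] := pselect (dom i q); last by exists 1 => // -[].
  exists `|phi i p - phi i q|; last by rewrite ltxx => -[].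
  rewrite normr_gt0 subr_eq0; apply/eqP => pqE; apply: pq.
  by rewrite -(ccoordK ip) pqE ccoordK.
have [r [eta [r_gt0 _ eta0 short]]] := short_curve_in_chart F (cimg_ccoord ip) r00.
apply: (lt_le_trans eta0); apply: finsler_dist_ge => // l [a [b [g [ab pg ga gb ->]]]].
rewrite leNgt; apply/negP => lshort; apply: Hq.
have [P [u lp]] := length_primitiveP F ab pg.
have := short a b g P u (phi i p) lp; rewrite subrr normr0 ccoordK//.
by move=> /(_ r_gt0 ga lshort b (ltW ab) (lexx b)); rewrite gb.
Qed.

End LocalDistance.

(** * From weights to Randers changes *)

Section Weighted.
Variables (R : realType) (n : nat) (M : manifold R n).
Local Notation dom i := (cdom (@atlas R n M i)).
Local Notation phi i := (ccoord (@atlas R n M i)).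
Local Notation psi i := (cinv (@atlas R n M i)).
Implicit Types (i : Defs.index M).
Variable F : finsler_metric M.

(** Without the factor 1/2 this is the coordinate expression of dw itself. *)
Definition odd_expr i (x y : 'rV[R]_n) : R :=
  local_expr F i (x, y) - local_expr F i (x, - y).

Lemma odd_expr0 i x : odd_expr i x 0 = 0.
Proof. by rewrite /odd_expr oppr0 subrr. Qed.

Lemma odd_exprN i x y : odd_expr i x (- y) = - odd_expr i x y.
Proof. by rewrite /odd_expr opprK opprB. Qed.

Lemma odd_exprZ_gt0 i x (a : R) y : 0 < a -> odd_expr i x (a *: y) = a * odd_expr i x y.
Proof. by move=> a0; rewrite /odd_expr -scalerN !local_exprZ// mulrBr. Qed.

Lemma odd_exprZ i x (a : R) y : odd_expr i x (a *: y) = a * odd_expr i x y.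
Proof.
have [a0|a0|->] := ltgtP a 0; last by rewrite scale0r odd_expr0 mul0r.
  by rewrite -[a]opprK scaleNr odd_exprN odd_exprZ_gt0 ?oppr_gt0// !mulNr opprK.
exact: odd_exprZ_gt0.
Qed.

Lemma smooth_local_expr_l i (y : 'rV[R]_n) : y != 0 ->
  smooth_on (cimg (atlas i)) (fun x => local_expr F i (x, y)).
Proof.
move=> y0.
have := smooth_on_affine (A := fun x : 'rV[R]_n => (x, y)) (T := fun v => (v, 0))
  _ _ (@finsler_smooth _ _ _ F i).
move=> H; apply: smooth_on_subset (H _ _) => [x ix|x v h|x].
- by split.
- by rewrite -[h *: (v, 0)]/(h *: v, h *: 0) -[_ + (_, _)]/(_ + _, _ + _) scaler0 add0r.
- exact: differentiable_pair.
Qed.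

Lemma smooth_odd_expr i (y : 'rV[R]_n) :
  smooth_on (cimg (atlas i)) (fun x => odd_expr i x y).
Proof.
have [->|y0] := eqVneq y 0.
  have -> : (fun x => odd_expr i x 0) = cst 0 by apply/funext => x; rewrite odd_expr0.
  by move=> k; exact: Ck_cst.
have -> : (fun x => odd_expr i x y) =
    (fun x => local_expr F i (x, y)) + (-1) *: (fun x => local_expr F i (x, - y)).
  by apply/funext => x; rewrite /odd_expr !fctE scaleN1r.
apply: smooth_onD; [exact: cimg_open|exact: smooth_local_expr_l|].
apply: smooth_onZ; [exact: cimg_open|apply: smooth_local_expr_l].
by rewrite oppr_eq0.
Qed.

Variable w : M -> R.
Hypothesis w_weight :
  forall x y, finsler_dist F x y + w x = finsler_dist F y x + w y.

Lemma weight_strict_derivative i x0 (e : R) : cimg (atlas i) x0 -> 0 < e ->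
  exists2 r, 0 < r & forall x1 x2, `|x0 - x1| < r -> `|x0 - x2| < r ->
    `|w (psi i x2) - w (psi i x1) - odd_expr i x0 (x2 - x1)| <= e * `|x2 - x1|.
Proof.
move=> ix0 e0; have [c [C [c0 C0 bnd]]] := local_expr_bounds F ix0.
(* The two distances contribute errors d F(y) and d F(-y), together at most 2 d C |y| <= e |y|; the
   bound 1 / 2 only ensures d < 1. *)
pose d := Num.min (e / (2 * C)) (1 / 2).
have d0 : 0 < d by rewrite lt_min !divr_gt0// mulr_gt0.
have d1 : d < 1 by rewrite gt_min; apply/orP; right; lra.
have [r r0 H] := finsler_dist_local F ix0 d0 d1.
exists r => // x1 x2 x1r x2r; set y := x2 - x1.
have [_ _] := H x1 x2 x1r x2r; have [_ _] := H x2 x1 x2r x1r.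
rewrite -(opprB x2 x1) -/y /odd_expr.
have := w_weight (psi i x1) (psi i x2).
have /andP[_ b1] := nbhs_singleton bnd y.
have /andP[_ b2] := nbhs_singleton bnd (- y).
have dC : d * (C * `|y|) <= e / 2 * `|y|.
  rewrite mulrA ler_wpM2r// -ler_pdivlMr//.
  have -> : e / 2 / C = e / (2 * C) by field; rewrite gt_eqF.
  by rewrite ge_min lexx.
rewrite normrN in b2.
have b1' := ler_wpM2l (ltW d0) b1; have b2' := ler_wpM2l (ltW d0) b2.
move: b1' b2' dC; set d12 := finsler_dist _ _ _; set d21 := finsler_dist _ _ _.
set l1 := local_expr _ _ _; set l2 := local_expr _ _ _; set m := `|y|.
rewrite ler_norml; clear H.
move=> b1' b2' dC wE /andP[h1 h2] /andP[h3 h4]; apply/andP; split; lra.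
Qed.

(** Along the triangle x0, x0 + t y1, x0 + t (y1 + y2) the increments of [w] add up exactly. The
    second side does not start at [x0], which is where strict differentiability is needed. *)
Lemma odd_exprD i x0 y1 y2 : cimg (atlas i) x0 ->
  odd_expr i x0 (y1 + y2) = odd_expr i x0 y1 + odd_expr i x0 y2.
Proof.
move=> ix0; apply/eqP; rewrite -subr_eq0 -normr_eq0.
set D := `| _ |; have D0 : 0 <= D by exact: normr_ge0.
rewrite eq_le D0 andbT leNgt; apply/negP => Dgt.
pose m := `|y1| + `|y2|; have m0 : 0 <= m by rewrite addr_ge0.
(* After division by t the three errors add up to at most 2 m e, which this choice makes smaller
   than the defect [D]; the + 1 covers m = 0. *)
pose e := D / (2 * m + 1).
have m1 : 0 < 2 * m + 1 by rewrite ltr_wpDl// mulr_ge0.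
have e0 : 0 < e by rewrite divr_gt0.
have [r r0 H] := weight_strict_derivative ix0 e0.
pose t := r / (m + 1); have m1' : 0 < m + 1 by rewrite ltr_wpDl.
have t0 : 0 < t by rewrite divr_gt0.
have tm : t * m < r.
  by rewrite /t -mulrA gtr_pMr// mulrC ltr_pdivrMr// mul1r ltrDl.
clearbody t; pose a := x0; pose b := x0 + t *: y1; pose c := x0 + t *: (y1 + y2).
have ar : `|x0 - a| < r by rewrite subrr normr0.
have br : `|x0 - b| < r.
  rewrite /b opprD addNKr normrN normrZ gtr0_norm//; apply: le_lt_trans tm.
  by rewrite ler_pM2l// lerDl.
have cr : `|x0 - c| < r.
  rewrite /c opprD addNKr normrN normrZ gtr0_norm//; apply: le_lt_trans tm.
  by rewrite ler_pM2l// ler_normD.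
have := H a b ar br; have := H b c br cr; have := H a c ar cr.
have -> : c - a = t *: (y1 + y2) by rewrite /c addrC addKr.
have -> : b - a = t *: y1 by rewrite /b addrC addKr.
have -> : c - b = t *: y2 by apply/rowP => k; rewrite /c /b !mxE; ring.
rewrite !odd_exprZ !normrZ. rewrite (gtr0_norm t0).
have ym : `|y1 + y2| <= m by exact: ler_normD.
have De : e * (2 * m) < D.
  by rewrite /e mulrAC ltr_pdivrMr// ltr_pM2l// ltrDl.
set wa := w (psi i a); set wb := w (psi i b); set wc := w (psi i c).
set o12 := odd_expr i x0 (y1 + y2); set o1 := odd_expr i x0 y1.
set o2 := odd_expr i x0 y2.
move=> h1 h2 h3; have : t * D <= t * (e * (2 * m)).
  have -> : t * D = `|(wc - wb - t * o2) + (wb - wa - t * o1) - (wc - wa - t * o12)|.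
    by rewrite /D -/o12 -/o1 -/o2 -{1}(gtr0_norm t0) -normrM; congr `|_|; ring.
  rewrite (le_trans (ler_normB _ _))//.
  apply: (le_trans (lerD (le_trans (ler_normD _ _) (lerD h2 h3)) h1)).
  have -> : t * (e * (2 * m)) = e * (t * `|y2|) + e * (t * `|y1|) + e * (t * m).
    by rewrite /m; ring.
  by rewrite lerD2l ler_pM2l// ler_pM2l.
by rewrite ler_pM2l// leNgt De.
Qed.

Lemma odd_expr_bound i x0 : cimg (atlas i) x0 ->
  exists2 C, 0 < C & forall y, `|odd_expr i x0 y| <= C * `|y|.
Proof.
move=> ix0; have [c [C [c0 C0 bnd]]] := local_expr_bounds F ix0.
exists C => // y; rewrite /odd_expr.
have /andP[_ b1] := nbhs_singleton bnd y.
have /andP[_ b2] := nbhs_singleton bnd (- y).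
have p1 := local_expr_ge0 F i (x0, y); have p2 := local_expr_ge0 F i (x0, - y).
by rewrite normrN in b2; rewrite ler_norml; apply/andP; split; lra.
Qed.

Lemma weight_differentiable i x0 : cimg (atlas i) x0 ->
  differentiable (w \o psi i) x0 /\
  'd (w \o psi i) x0 = odd_expr i x0 :> ('rV[R]_n -> R).
Proof.
move=> ix0.
have lin : linear (odd_expr i x0).
  by move=> a u v; rewrite odd_exprD// odd_exprZ.
pose lm := GRing.isLinear.Build R 'rV[R]_n R _ (odd_expr i x0) lin.
pose l : {linear 'rV[R]_n -> R} := HB.pack (odd_expr i x0) lm.
apply: (@differentiable_littleoP _ _ _ _ l).
  apply: bounded_linear_continuous; apply/linear_boundedP.
  have [C C0 bC] := odd_expr_bound ix0; exists C; split; first exact: num_real.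
  move=> K CK y; apply: le_trans (bC y) _; rewrite ler_wpM2r//; exact: ltW.
move=> e e0; have [r r0 H] := weight_strict_derivative ix0 e0.
apply/nbhs_normP; exists r => //= h; rewrite /ball_ /= sub0r normrN => hr.
have := H x0 (h + x0); rewrite subrr normr0 addrK => /(_ r0); apply.
by rewrite opprD addrCA subrr addr0 normrN.
Qed.

(** The directional derivatives of [w] are the functions x |-> [odd_expr] x v, already smooth
    because F is; no induction on the order of differentiability of [w] is required. *)
Lemma smooth_weight : smooth_function w.
Proof.
move=> i [|k].
  by move=> x ix; apply/differentiable_continuous; exact: (weight_differentiable ix).1.
split=> [x ix|v]; first exact: (weight_differentiable ix).1.
suff : Ck k (cimg (atlas i)) ('D_v (w \o psi i)) by [].
apply: (@Ck_eq _ _ _ _ _ (fun x => odd_expr i x v)).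
- exact: cimg_open.
- by move=> x ix; have [dw dE] := weight_differentiable ix; rewrite deriveE// dE.
- exact: smooth_odd_expr.
Qed.

End Weighted.

(** * The even metric and the exact form attached to a weight *)

Section RandersDecomposition.
Variables (R : realType) (n : nat) (M : manifold R n).
Local Notation dom i := (cdom (@atlas R n M i)).
Local Notation phi i := (ccoord (@atlas R n M i)).
Local Notation psi i := (cinv (@atlas R n M i)).
Implicit Types (i : Defs.index M).
Variables (F : finsler_metric M) (w : M -> R).
Hypothesis w_weight :
  forall x y, finsler_dist F x y + w x = finsler_dist F y x + w y.

Definition odd_part p (v : tangent p) : R := 2^-1 * (F p v - F p (- v)).

Definition even_part p (v : tangent p) : R := 2^-1 * (F p v + F p (- v)).

Lemma odd_part_tvec i p (y : 'rV[R]_n) : dom i p ->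
  odd_part (tvec i p y) = 2^-1 * odd_expr F i (phi i p) y.
Proof. by move=> ip; rewrite /odd_part -tvecN !local_exprE. Qed.

Lemma odd_part_linear p : scalar (@odd_part p).
Proof.
move=> a u v; have ip := projT2 (cid (atlas_cover p)); set i := projT1 _ in ip.
rewrite -(tcoordK u ip) -(tcoordK v ip) -linearP !odd_part_tvec//.
rewrite (odd_exprD w_weight); last exact: cimg_ccoord.
by rewrite odd_exprZ mulrDr mulrCA.
Qed.

Definition odd_scalar p : {scalar tangent p} :=
  HB.pack (@odd_part p)
    (GRing.isLinear.Build R (tangent p) R *%R (@odd_part p) (@odd_part_linear p)).

Lemma odd_scalar_smooth i (y : 'rV[R]_n) :
  smooth_on (cimg (atlas i)) (fun x => odd_scalar (psi i x) (tvec i (psi i x) y)).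
Proof.
have -> : (fun x => odd_scalar (psi i x) (tvec i (psi i x) y)) =
    2^-1 *: (fun x => odd_expr F i x y).
  by apply/funext => x; rewrite /= /odd_part -tvecN.
by apply: smooth_onZ; [exact: cimg_open|exact: smooth_odd_expr].
Qed.

Definition odd_form : one_form M := OneForm odd_scalar_smooth.

Lemma odd_form_exact : exact_form odd_form.
Proof.
exists (2^-1 *: w); split.
  move=> i; have -> : (2^-1 *: w) \o psi i = 2^-1 *: (w \o psi i) by [].
  by apply: smooth_onZ; [exact: cimg_open|exact: smooth_weight w_weight i].
move=> i p ip v; have [dw dE] := weight_differentiable w_weight (cimg_ccoord ip).
have -> : (2^-1 *: w) \o psi i = 2^-1 *: (w \o psi i) by [].
rewrite diffZ//.
have -> : odd_form p v = 2^-1 * odd_expr F i (phi i p) (v i).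
  by rewrite -odd_part_tvec// tcoordK.
by rewrite -dE.
Qed.

Lemma even_part_ge0 p (v : tangent p) : 0 <= even_part v.
Proof. by rewrite mulr_ge0// addr_ge0// finsler_ge0. Qed.

Lemma even_part_homogeneous p (v : tangent p) (l : R) :
  0 < l -> even_part (l *: v) = l * even_part v.
Proof.
move=> l0; rewrite /even_part -scalerN !finsler_homogeneous//.
by rewrite -mulrDr mulrCA.
Qed.

Lemma even_part_smooth i :
  smooth_on [set z | cimg (atlas i) z.1 /\ z.2 != 0] (local_expr even_part i).
Proof.
pose flip (z : 'rV[R]_n * 'rV[R]_n) := (z.1, - z.2).
have -> : local_expr even_part i =
    2^-1 *: (local_expr F i + (local_expr F i \o flip)).
  by apply/funext => z; rewrite !fctE /local_expr /= /even_part tvecN.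
apply: smooth_onZ; first exact: open_slit.
apply: smooth_onD; [exact: open_slit|exact: finsler_smooth|].
apply: smooth_on_subset (smooth_on_affine (A := flip) (T := flip) _ _ (@finsler_smooth _ _ _ F i)).
- by move=> z /= [iz z0]; split; rewrite //= oppr_eq0.
- move=> z v h; rewrite -[RHS]/(h *: v.1 + z.1, h *: - v.2 - z.2) scalerN.
  by rewrite /flip /= opprD.
- move=> z.
  have d1 : differentiable (fst : 'rV[R]_n * 'rV[R]_n -> 'rV[R]_n) z.
    by apply: linear_differentiable => u; exact: cvg_fst.
  have d2 : differentiable (snd : 'rV[R]_n * 'rV[R]_n -> 'rV[R]_n) z.
    by apply: linear_differentiable => u; exact: cvg_snd.
  exact: (differentiable_pair d1 (differentiableN d2)).
Qed.

Lemma even_part_convex i p : dom i p -> forall y u : 'rV[R]_n,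
  y != 0 -> u != 0 -> 0 < fibre_hessian even_part i p y u u.
Proof.
move=> ip.
pose f y := F p (tvec i p y).
have lin : linear (fun y => odd_part (tvec i p y)).
  by move=> a y z; rewrite linearP odd_part_linear.
pose lm := GRing.isLinear.Build R 'rV[R]_n R _ _ lin.
pose l : {linear 'rV[R]_n -> R} := HB.pack (fun y => odd_part (tvec i p y)) lm.
have cl : continuous l.
  apply: bounded_linear_continuous; apply/linear_boundedP.
  have [C C0 bC] := odd_expr_bound F (cimg_ccoord ip).
  exists C; split; first exact: num_real.
  move=> K CK y; rewrite /= odd_part_tvec// normrM gtr0_norm ?invr_gt0//.
  apply: (@le_trans _ _ (C * `|y|)); last by rewrite ler_wpM2r// ltW.
  apply: (@le_trans _ _ `|odd_expr F i (phi i p) y|); last exact: bC.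
  by rewrite ler_piMl// invf_le1// ler1n.
have fl y : f y - l y = even_part (tvec i p y).
  by rewrite /f /= /odd_part /even_part; field.
(* Subtracting a linear form preserves Minkowski norms only if the result stays positive; here it is
   an average of two values of F. *)
have pos y : y != 0 -> 0 < f y - l y.
  move=> y0; rewrite fl mulr_gt0 ?invr_gt0// ltr_wpDr ?finsler_ge0//.
  by rewrite finsler_gt0// tvec_eq0.
have [_ _ _ H] := minkowski_sub_linear cl (minkowski_fibre F ip) pos.
move=> y u y0 u0; have := H y u y0 u0.
rewrite /fibre_hessian.
have -> : (fun z => 2^-1 * (F p (tvec i p z) - l z) ^+ 2) =
    (fun z => 2^-1 * even_part (tvec i p z) ^+ 2); last by [].
by apply/funext => z; rewrite -fl.
Qed.

Definition even_metric : finsler_metric M :=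
  FinslerMetric even_part_ge0 even_part_smooth even_part_homogeneous even_part_convex.

Lemma weighted_randers : exists (F0 : finsler_metric M) (beta : one_form M),
  [/\ absolute_homogeneous F0, exact_form beta & randers_change F F0 beta].
Proof.
exists even_metric, odd_form; split; [|exact: odd_form_exact|].
  by move=> p v _; rewrite /= /even_part opprK addrC.
by move=> p v; rewrite /= /even_part /odd_part; field.
Qed.

End RandersDecomposition.

(** * From Randers changes to weights *)

Section RandersWeighted.
Variables (R : realType) (n : nat) (M : manifold R n).
Local Notation dom i := (cdom (@atlas R n M i)).
Local Notation phi i := (ccoord (@atlas R n M i)).
Local Notation psi i := (cinv (@atlas R n M i)).
Implicit Types (i : Defs.index M) (g : R -> M).

Section Reversal.
Variables (F F0 : finsler_metric M) (beta : one_form M) (f : M -> R).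
Hypothesis F0_abs : absolute_homogeneous F0.
Hypothesis f_smooth : smooth_function f.
Hypothesis f_beta : is_differential f beta.
Hypothesis F_randers : randers_change F F0 beta.

Lemma randers_opp p (v : tangent p) : F p (- v) = F p v - 2 * beta p v.
Proof.
rewrite !F_randers linearN.
(* Absolute homogeneity is stated for nonzero vectors, hence the case v = 0. *)
have -> : F0 p (- v) = F0 p v.
  by have [->|v0] := eqVneq v 0; [rewrite oppr0|exact: F0_abs].
by ring.
Qed.

Lemma smooth_function_continuous p : {for p, continuous f}.
Proof.
have ip := projT2 (cid (atlas_cover p)); set i := projT1 _ in ip.
have c1 : {for p, continuous ((f \o psi i) \o phi i)}.
  apply: continuous_comp; first exact: ccoord_continuous.
  by apply: (f_smooth i 0%N); exact: cimg_ccoord.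
rewrite /prop_for /continuous_at -{2}(ccoordK ip); apply: cvg_trans c1.
by apply: near_eq_cvg; apply: filterS (cdom_nbhs ip) => q iq /=; rewrite ccoordK.
Qed.

Lemma smooth_function_curve g t : regular_at g t ->
  is_derive t 1 (f \o g) (beta (g t) (velocity g t)).
Proof.
move=> rg; have it := projT2 (cid (atlas_cover (g t))); set i := projT1 _ in it.
have df : differentiable (f \o psi i) (phi i (g t)).
  exact: (smooth_on_differentiable (f_smooth i) (cimg_ccoord it)).
have dg := rg.2 i it.
have dfg : differentiable ((f \o psi i) \o (phi i \o g)) t.
  exact: differentiable_comp.
apply: (@near_eq_is_derive _ _ _ ((f \o psi i) \o (phi i \o g))).
  by apply: filterS (regular_near_dom rg it) => s is_ /=; rewrite ccoordK.
split; first exact: diff_derivable.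
rewrite (f_beta it) (velocity_chart rg it) (tvecK _ it) (derive1E' dg).
by rewrite (deriveE _ dfg) (diff_comp dg df).
Qed.

(** On the reversed curve the speed is F(-v) = F(v) - 2 beta(v), and beta(v) is the derivative of
    [f] along the curve, so the correction depends on the end points only. *)
Lemma lengths_rev x y l : lengths F x y l -> lengths F y x (l + 2 * f x - 2 * f y).
Proof.
move=> [a [b [g [ab pg ga gb lE]]]].
pose sigma (t : R) := -1 * t + 0; have sE t : sigma t = - t by rewrite /sigma; ring.
have ba : - b < - a by rewrite ltrN2.
have pr := piecewise_smooth_rev pg; have [P [u lp]] := length_primitiveP F ab pg.
have [P' [u' lp']] := length_primitiveP F ba pr.
exists (- b), (- a), (g \o sigma); split; [exact: ba|exact: pr| | |].
- by rewrite /= sE opprK.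
- by rewrite /= sE opprK.
rewrite (lp_length lp') lE (lp_length lp) -ga -gb.
(* [k] has the shape that the chain rule produces for [v], with a factor -1 from each composition
   with [sigma]; its value is F(-v). *)
pose k t := - (-1 * speed F g (sigma t)) + 2 * (-1 * beta (g (sigma t)) (velocity g (sigma t))).
pose v t := - u (sigma t) + 2 * f (g (sigma t)).
have -> : u b - u a + 2 * f (g a) - 2 * f (g b) = v (- a) - v (- b).
  by rewrite /v !sE !opprK; ring.
pose Q := [seq - t | t <- P].
have sP t : t \notin Q -> sigma t \notin P.
  by apply: contra => tP; apply/mapP; exists (sigma t) => //; rewrite sE opprK.
have sI t : t \in `]- b, - a[ -> sigma t \in `]a, b[.
  by rewrite !in_itv /= sE ltrNr ltrNl andbC.
have pv : primitive_off Q (- b) (- a) k v.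
  split.
    have -> : `[- b, - a]%classic = sigma @^-1` `[a, b]%classic.
      by apply/seteqP; split=> t /=; rewrite !in_itv /= sE lerNr lerNl andbC.
    apply: (@within_continuous_affine R (-1) 0 R `[a, b] (fun s => - u s + 2 * f (g s))).
    have cu := (lp_primitive lp).1.
    have cf := @within_continuous_postcomp R M R `[a, b]%classic g f (lp_continuous lp)
        (fun t _ => @smooth_function_continuous (g t)).
    move=> t; apply: cvgD; first by apply: cvgN; exact: cu.
    by apply: cvgMl_tmp; exact: cf.
  move=> t tI tP; have rt := lp_regular lp (sI t tI) (sP t tP).
  have d1 := is_derive_affine ((lp_primitive lp).2 _ (sI t tI) (sP t tP)).
  have d2 := is_derive_affine (smooth_function_curve rt).
  exact: is_deriveD (is_deriveN d1) (is_deriveZ 2 d2).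
apply: (primitive_off_eq (ltW ba) pv (lp_primitive lp')) => t tI.
rewrite mem_cat negb_or => /andP[tP _].
have rt := lp_regular lp (sI t tI) (sP t tP).
have it := projT2 (cid (atlas_cover (g (sigma t)))).
rewrite (speed_affine F rt it) scaleN1r -local_exprE// tvecN.
rewrite -(velocity_chart rt it) randers_opp /k /speed.
by ring.
Qed.

End Reversal.
End RandersWeighted.

(** * Connectedness by curves and the quasi-metric axioms *)

Section QuasiMetric.
Variables (R : realType) (n : nat) (M : manifold R n).
Local Notation dom i := (cdom (@atlas R n M i)).
Local Notation phi i := (ccoord (@atlas R n M i)).
Local Notation psi i := (cinv (@atlas R n M i)).
Variable F : finsler_metric M.

Lemma near_lengths (p : M) : \forall q \near p, \forall q' \near p,
  lengths F q q' !=set0.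
Proof.
have ip := projT2 (cid (atlas_cover p)); set i := projT1 _ in ip.
have e0 : (0 : R) < 1 / 2 by lra. have e1 : 1 / 2 < 1 :> R by lra.
have [r r0 H] := finsler_dist_local F (cimg_ccoord ip) e0 e1.
have nr : \forall q \near p, dom i q /\ `|phi i p - phi i q| < r.
  apply: filterI; first exact: cdom_nbhs.
  have cphi := @ccoord_continuous _ _ _ (atlas i) _ ip.
  have nz : \forall z \near phi i p, `|phi i p - z| < r.
    by apply/nbhs_normP; exists r.
  exact: (cphi [set z | `|phi i p - z| < r] nz).
apply: filterS (nr) => q [iq qr]; apply: filterS nr => q' [iq' qr'].
by have [_] := H _ _ qr qr'; rewrite !ccoordK.
Qed.

(** Being joined to [x] by a piecewise smooth curve propagates along a continuous path by real
    induction, each step appending a short curve inside a chart. *)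
Lemma lengths_nonempty (x y : M) : simply_connected R M -> lengths F x y !=set0.
Proof.
move=> [/(_ x y)[g [cg g0 g1]] _]; rewrite -g1.
have concat_ne p q s : lengths F p q !=set0 -> lengths F q s !=set0 ->
    lengths F p s !=set0.
  by move=> [l pl] [m qm]; exists (l + m); exact: lengths_concat qm.
have refl p : lengths F p p !=set0.
  exact: (nbhs_singleton (nbhs_singleton (near_lengths p))).
have ends t : 0 <= t -> t <= 1 -> exists2 e, 0 < e & forall s, 0 <= s -> s <= 1 ->
    `|t - s| < e -> lengths F (g s) (g t) !=set0 /\ lengths F (g t) (g s) !=set0.
  move=> t0 t1; have near_gt : \forall q \near g t,
      lengths F q (g t) !=set0 /\ lengths F (g t) q !=set0.
    have H := near_lengths (g t); apply: filterI; last exact: nbhs_singleton H.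
    by apply: filterS H => q; exact: nbhs_singleton.
  exact: within_continuous_near cg t0 t1 near_gt.
apply: (@itv_induction R 0 1 (fun t => lengths F x (g t) !=set0)) => //.
- by rewrite g0.
- move=> t t0 t1 H; have [e e0 eN] := ends t (ltW t0) t1.
  pose s := Num.max 0 (t - e / 2).
  have s0 : 0 <= s by rewrite le_max lexx.
  have st : s < t by rewrite gt_max t0 /=; lra.
  have ts : t - e / 2 <= s by rewrite le_max lexx orbT.
  have [|sg _] := eN s s0 (le_trans (ltW st) t1).
    by rewrite gtr0_norm ?subr_gt0//; lra.
  exact: concat_ne (H s s0 st) sg.
- move=> t t0 t1 H; have [e e0 eN] := ends t t0 t1; exists e => // s ts se s1.
  have [|_ tg] := eN s (le_trans t0 (ltW ts)) s1.
    by rewrite ltr0_norm ?subr_lt0//; lra.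
  exact: concat_ne H tg.
Qed.

(** The upper half of the local comparison with equal end points gives the bound 0. *)
Lemma finsler_dist_refl x : finsler_dist F x x = 0.
Proof.
apply/le_anti; rewrite finsler_dist_ge0 andbT.
have ix := projT2 (cid (atlas_cover x)); set i := projT1 _ in ix.
have e0 : (0 : R) < 1 / 2 by lra. have e1 : 1 / 2 < 1 :> R by lra.
have [r r0 H] := finsler_dist_local F (cimg_ccoord ix) e0 e1.
have := H (phi i x) (phi i x); rewrite !subrr normr0 => /(_ r0 r0)[_ _].
by rewrite local_expr0 !mulr0 ccoordK// => /andP[].
Qed.

Lemma finsler_quasi_metric : simply_connected R M -> quasi_metric (finsler_dist F).
Proof.
move=> hM; have pos x y : x <> y -> 0 < finsler_dist F x y.
  by apply: finsler_dist_gt0; exact: lengths_nonempty.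
split=> [x y|x|//|x y z|x y xy _].
- exact: finsler_dist_ge0.
- exact: finsler_dist_refl.
- by apply: finsler_dist_triangle; exact: lengths_nonempty.
- by apply: contrapT => /pos; rewrite xy ltxx.
Qed.

End QuasiMetric.

Lemma randers_weighted (R : realType) (n : nat) (M : manifold R n)
    (F F0 : finsler_metric M) (beta : one_form M) :
  simply_connected R M -> absolute_homogeneous F0 -> exact_form beta ->
  randers_change F F0 beta ->
  exists w : M -> R, forall x y,
    finsler_dist F x y + w x = finsler_dist F y x + w y.
Proof.
move=> hM F0_abs [f [f_smooth f_beta]] FR; exists (2 *: f).
(* Every curve from [x] to [y] reverses to one whose length is known, and passing to the infimum
   gives one inequality; exchanging [x] and [y] gives the other. *)
have le x y : finsler_dist F y x - 2 * f x + 2 * f y <= finsler_dist F x y.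
  apply: finsler_dist_ge => [|l xyl]; first exact: lengths_nonempty.
  have := finsler_dist_le (lengths_rev F0_abs f_smooth f_beta FR xyl).
  by clear; lra.
move=> x y; have h1 := le x y; have h2 := le y x.
rewrite -[(2 *: f) x]/(2 * f x) -[(2 *: f) y]/(2 * f y).
by apply/le_anti/andP; split; lra.
Qed.

Theorem theorem2p3 (R : realType) (n : nat) (M : manifold R n)
    (hM : simply_connected R M) (F : finsler_metric M) :
  generalized_weighted (finsler_dist F) <->
  exists (F0 : finsler_metric M) (beta : one_form M),
    [/\ absolute_homogeneous F0, exact_form beta & randers_change F F0 beta].
Proof.
split=> [[_ [w w_weight]]|[F0 [beta [F0_abs beta_exact FR]]]].
  exact: weighted_randers w_weight.
split; first exact: finsler_quasi_metric.
exact: randers_weighted hM F0_abs beta_exact FR.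
Qed.
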